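(* For any prime $p\ne2,3$, the Ramanujan vector field $$\mathsf v=(t_1^2-\tfrac1{12}t_2)\frac{\partial}{\partial t_1}+(4t_1t_2-6t_3)\frac{\partial}{\partial t_2}+(6t_1t_3-\tfrac13t_2^2)\frac{\partial}{\partial t_3}$$ in $\mathbb A^3_{\mathbb F_p}$ has a first integral $f\in\mathbb F_p[t_1,t_2,t_3]$, $f\neq 0$, that is, $\mathsf v(f)=0$, which is a homogeneous polynomial of degree $p+1$ with respect to the weights $\deg(t_i)=2i$, $i=1,2,3$. Moreover, $\mathsf v$ restricted to $\{f=0\}$ has a regular first integral $A$ (a non-constant regular function on $\{f=0\}$ with $\mathsf v(A)=0$ on $\{f=0\}$), and the curve $\{A=1,\ f=0\}$ is a curve in $\mathbb A^3_{\mathbb F_p}$ which passes through $a:=(-\frac1{12},\frac1{12},-\frac1{216})$, is smooth at $a$, is tangent to the vector $b=(2,20,\frac73)$ at $a$, is tangent to $\mathsf v$, and on which $\mathsf v^p=\mathsf v$.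
   Context: $\mathsf v$ is viewed as a derivation of $\mathbb F_p[t_1,t_2,t_3]$, and $\mathsf v^p$ is its $p$-fold iterate, which is again a derivation. For a curve with ideal $I$, ''tangent to $\mathsf v$'' means $\mathsf v(I)\subset I$, and ''$\mathsf v^p=\mathsf v$ on the curve'' means $\mathsf v^p(g)-\mathsf v(g)\in I$ for all $g\in\mathbb F_p[t_1,t_2,t_3]$. *)

(* Defs.v *)
From HB Require Import structures.
From mathcomp Require Import all_boot all_order all_algebra ring_quotient.
From mathcomp Require Export mpoly.

Set Implicit Arguments.
Unset Strict Implicit.
Unset Printing Implicit Defensive.

Import GRing.Theory.
Local Open Scope ring_scope.

(* The variables t_1, t_2, t_3 are 'X_i for i = 0, 1, 2 in 'I_3. *)

Definition wt (m : 'X_{1..3}) : nat := (\sum_(i < 3) m i * (2 * i.+1))%N.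

Fact wt0 : wt 0%MM = 0%N.
Proof. by rewrite /wt big1 // => i _; rewrite mnm0E mul0n. Qed.

Fact wtD : {morph wt : m1 m2 / (m1 + m2)%MM >-> (m1 + m2)%N}.
Proof.
by move=> m1 m2; rewrite /wt -big_split; apply: eq_bigr => i _; rewrite mnmDE mulnDl.
Qed.

HB.instance Definition _ := isMeasure.Build 3 wt wt0 wtD.

Section Ramanujan.
Variable F : fieldType.

Let t1 : {mpoly F[3]} := 'X_(inord 0).
Let t2 : {mpoly F[3]} := 'X_(inord 1).
Let t3 : {mpoly F[3]} := 'X_(inord 2).

Definition ramanujan (g : {mpoly F[3]}) : {mpoly F[3]} :=
    (t1 ^+ 2 - (1 / 12%:R) *: t2) * mderiv (inord 0) g
  + (4%:R * t1 * t2 - 6%:R * t3) * mderiv (inord 1) g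
  + (6%:R * t1 * t3 - (1 / 3%:R) *: t2 ^+ 2) * mderiv (inord 2) g.

Definition vec3 (x y z : F) : 'cV[F]_3 := \col_i [tuple x; y; z]`_i.

End Ramanujan.

Section ClosedSubschemes.
Variables (F : fieldType) (n : nat).
Local Notation S := {mpoly F[n]}.
Implicit Types (I : S -> Prop) (P Q : {pred S}).

Definition ideal_gen k (h : k.-tuple S) (g : S) : Prop :=
  exists c : 'I_k -> S, g = \sum_i c i * tnth h i.

(* [idealr_closed] already contains 1 \notin P *)
Definition prime_over I P : Prop :=
  [/\ idealr_closed P, prime_idealr_closed P & forall g, I g -> g \in P].

Definition minimal_prime_over I P : Prop :=
  prime_over I P /\ forall Q, prime_over I Q -> {subset Q <= P} -> {subset P <= Q}.

Definition has_prime_chain I (d : nat) : Prop :=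
  exists P : nat -> {pred S},
    (forall i, (i <= d)%N -> prime_over I (P i)) /\
    (forall i, (i < d)%N ->
       {subset P i <= P i.+1} /\ ~ {subset P i.+1 <= P i}).

(* Krull dimension of S / I *)
Definition krull_dim I (d : nat) : Prop :=
  has_prime_chain I d /\ ~ has_prime_chain I d.+1.

(* V(I) is nonempty and all its irreducible components have dimension 1 *)
Definition is_curve I : Prop :=
  ~ I 1 /\ forall P, minimal_prime_over I P -> krull_dim (fun g => g \in P) 1.

Definition eval_at (a : 'cV[F]_n) (g : S) : F := g.@[fun i => a i 0].

Definition passes_through I (a : 'cV[F]_n) : Prop :=
  forall g, I g -> eval_at a g = 0.

Definition tangent_to_vector I (a b : 'cV[F]_n) : Prop :=
  forall g, I g -> \sum_i eval_at a (mderiv i g) * b i 0 = 0.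

Definition jacobian k (h : k.-tuple S) (a : 'cV[F]_n) : 'M[F]_(k, n) :=
  \matrix_(i, j) eval_at a (mderiv j (tnth h i)).

(* Jacobian criterion at a point a of a curve in affine n-space cut out by h *)
Definition smooth_curve_at k (h : k.-tuple S) (a : 'cV[F]_n) : Prop :=
  \rank (jacobian h a) = n.-1.

End ClosedSubschemes.

(* Main.v *)
From HB Require Import structures.
Require Import Defs.
From mathcomp Require Import all_boot all_order all_algebra.
From mathcomp Require Import ring_quotient polyXY ring zify.
From mathcomp Require Import boolp classical_sets.
Import GRing.Theory.
Local Open Scope ring_scope.

Set Implicit Arguments.
Unset Strict Implicit.
Unset Printing Implicit Defensive.

(** Let F be a field of characteristic p = 2 s + 1 > 3. The field v is the modular vector
    field of the family of cubics y^2 = P(x), where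
    P = 4 (x - t1)^3 - t2 (x - t1) - t3: the Gauss-Manin connection along v sends dx / y to
    - x dx / y and x dx / y to 0. In characteristic p, the coefficient of x^(p-1) kills every
    derivative in x, and P^s can play the role of 1 / y because s = -1/2 in F. Hence
    h dx / y |-> [x^(p-1)] (h P^s) is a horizontal functional, and its values
    A = [x^(p-1)] P^s, which is the Hasse invariant, and f = [x^(p-1)] (x P^s) satisfy
    v A = - f and v f = 0 ([ramanujan_hasse], [ramanujan_first_integral]). At the point a the
    cubic becomes x^2 (4 x + 1), so that the values and the gradients of A and f at a are
    low coefficients of powers of 1 + 4 x; this gives the point, the smoothness and the
    tangent.

    Differentiating in t1, that is, translating x, gives dA/dt1 = 0 and df/dt1 = A. By weight,
    A and B = f - t1 A belong to F[t2, t3], so the locus A = 1, f = 0 is the graph of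
    t1 = - B over the plane curve A(t2, t3) = 1 ([is_curve_graph]). That a plane curve has
    dimension 1 comes from divisions with respect to one of the two variables: a prime of
    R[X] that is not extended from R cannot grow without its contraction growing
    ([prime_poly_contraction]), and a minimal prime over one equation is not maximal
    ([minimal_prime_extends]).

    Finally v, the Euler field E and d/dt1 span sl2, and on the whole space
    v^p = A^2 v - A f E + f^2 d/dt1 ([ramanujan_iter_p]), which is the p-curvature of the
    Gauss-Manin connection and reduces to v^p = v where A = 1 and f = 0. The difference of
    the two sides is a derivation of weight 2 p which commutes with v and with d/dt1, so
    its values at t1, t2, t3 satisfy a linear differential system. On a line through a
    transversal to the discriminant, this is a Fuchsian system whose exponents at a are
    0, 0 and 1 modulo p ([fuchs_polynomial_zero]). The values have degree less than p on
    the line, and they vanish there to order 2 at a, because a is a zero of v and v acts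
    by -1 on the tangent b; therefore they are zero. *)

Local Notation i0 := (inord 0 : 'I_3).
Local Notation i1 := (inord 1 : 'I_3).
Local Notation i2 := (inord 2 : 'I_3).

(** * Prime ideals and Krull's theorem *)

Definition prime_ideal (R : comNzRingType) (P : {pred R}) : Prop :=
  idealr_closed P /\ prime_idealr_closed P.

Section PrimeIdeal.
Variables (R : comNzRingType) (P : {pred R}).
Hypothesis Pprime : prime_ideal P.

Lemma prime0 : 0 \in P. Proof. by case: Pprime => -[]. Qed.
Lemma prime1 : 1 \notin P. Proof. by case: Pprime => -[]. Qed.
Lemma primeMl a x : x \in P -> a * x \in P.
Proof. by move=> Px; case: Pprime => -[P0 _ PD] _; rewrite -[_ * _]addr0; apply: PD. Qed.
Lemma primeMr a x : x \in P -> x * a \in P.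
Proof. by rewrite mulrC; apply: primeMl. Qed.
Lemma primeD x y : x \in P -> y \in P -> x + y \in P.
Proof. by case: Pprime => -[_ _ PD] _ Px Py; rewrite -[x]mul1r PD. Qed.
Lemma primeN x : x \in P -> - x \in P.
Proof. by move=> Px; rewrite -mulN1r primeMl. Qed.
Lemma primeB x y : x \in P -> y \in P -> x - y \in P.
Proof. by move=> Px Py; rewrite primeD ?primeN. Qed.
Lemma primeM x y : (x * y \in P) = (x \in P) || (y \in P).
Proof.
apply/idP/orP => [/(proj2 Pprime)/orP //|[]]; [exact: primeMr|exact: primeMl].
Qed.
Lemma primeX x n : x ^+ n \in P -> x \in P.
Proof.
elim: n => [|n IHn]; first by rewrite expr0 (negPf prime1).
by rewrite exprS primeM => /orP[].
Qed.
Lemma prime_congr x y : x - y \in P -> (x \in P) = (y \in P).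
Proof.
move=> Pxy; apply/idP/idP => [Px|Py]; last by rewrite -(subrK y x) primeD.
by rewrite -(subKr x y) primeB.
Qed.
End PrimeIdeal.

Lemma prime_preim (R R' : comNzRingType) (phi : {rmorphism R -> R'})
    (P : {pred R'}) :
  prime_ideal P -> prime_ideal [pred x | phi x \in P].
Proof.
move=> Pp; split; first split; rewrite ?inE.
- by rewrite rmorph0 prime0.
- by rewrite rmorph1 prime1.
- by move=> a u v; rewrite !inE rmorphD rmorphM => Pu Pv; rewrite primeD ?primeMl.
- by move=> u v; rewrite !inE rmorphM primeM.
Qed.

(** All the division arguments below run by minimal degree among elements that
    satisfy an undecidable condition. *)
Lemma ex_min_measure (T : Type) (m : T -> nat) (Q : T -> Prop) :
  (exists x, Q x) -> exists x, Q x /\ forall y, Q y -> (m x <= m y)%N.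
Proof.
case=> x Qx; have exn : exists n, `[< exists2 y, Q y & m y = n >].
  by exists (m x); apply/asboolP; exists x.
case: (ex_minnP exn) => n /asboolP[y Qy <-] min_n; exists y; split=> // z Qz.
by apply: min_n; apply/asboolP; exists z.
Qed.

(** Zorn's lemma gives an ideal maximal among those that contain [J] and avoid [M];
    if it contained a product u v but neither factor, adding u and adding v would
    both produce elements of [M], whose product would lie in the ideal. *)
Lemma prime_avoiding (R : comNzRingType) (J M : R -> Prop) :
  J 0 -> (forall a x y, J x -> J y -> J (a * x + y)) ->
  M 1 -> (forall x y, M x -> M y -> M (x * y)) ->
  (forall x, J x -> ~ M x) ->
  exists2 P : {pred R}, prime_ideal P &
    (forall x, J x -> x \in P) /\ (forall x, x \in P -> ~ M x).
Proof.
move=> J0 JD M1 MM JM.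
pose ideal (K : set R) := K 0 /\ forall a x y, K x -> K y -> K (a * x + y).
pose good (K : set R) := (forall x, J x -> K x) /\ ideal K /\ forall x, K x -> ~ M x.
(* The empty set is admitted because it is the union of the empty chain. *)
pose Q (X : set R) := X = set0 \/ good X.
have [X [QX maxX]] : exists X, Q X /\ forall Y, (X `<` Y)%classic -> ~ Q Y.
  apply: Zorn_bigcup => F FQ Ftot.
  have [[X0 [FX0 gX0]]|nogood] := pselect (exists X, F X /\ good X); last first.
    left; rewrite -subset0 => x [X FX Xx].
    by case: (FQ X FX) Xx => [->|gX] //; case: nogood; exists X.
  have Fgood X x : F X -> X x -> good X.
    by move=> FX Xx; case: (FQ X FX) => // X_0; rewrite X_0 in Xx.
  right; split; [|split; [split|]].
  - by move=> x Jx; exists X0 => //; apply: gX0.1.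
  - by exists X0 => //; apply: gX0.2.1.1.
  - move=> a x y [X FX Xx] [Y FY Yy].
    have gX := Fgood _ _ FX Xx; have gY := Fgood _ _ FY Yy.
    case: (Ftot X Y FX FY) => [XY|YX].
      by exists Y => //; apply: gY.2.1.2 => //; apply: XY.
    by exists X => //; apply: gX.2.1.2 => //; apply: YX.
  - by move=> x [X FX Xx]; apply: (Fgood _ _ FX Xx).2.2.
have gX : good X.
  case: QX => // X0; exfalso; apply: (maxX (J : set R)); last by right.
  by rewrite X0; split=> // /(_ 0 J0).
case: gX => JX [[X0 XD] XM].
have XA a x : X x -> X (a * x) by move=> Xx; rewrite -[_ * _]addr0; apply: XD.
have ext z : ~ X z -> exists a x, X x /\ M (a * z + x).
  move=> Xz; apply: contrapT => noM.
  apply: (maxX [set w | exists a x, X x /\ w = a * z + x]%classic).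
    split; last by apply: (contra_not _ Xz) => /(_ z); apply; exists 1, 0; rewrite mul1r addr0.
    by move=> x Xx; exists 0, x; rewrite mul0r add0r.
  right; split; [|split; [split|]].
  - by move=> x /JX Xx; exists 0, x; rewrite mul0r add0r.
  - by exists 0, 0; rewrite mul0r add0r.
  - move=> a _ _ [b [x [Xx ->]]] [c [y [Xy ->]]]; exists (a * b + c), (a * x + y).
    by split; [apply: XD|ring].
  - by move=> _ [a [x [Xx ->]]] Max; apply: noM; exists a, x.
exists (fun x => `[< X x >] : bool); last by split=> x; [move=> /JX Xx; apply/asboolP|move=> /asboolP /XM].
split; first split.
- by apply/asboolP.
- by apply/asboolP => /XM.
- by move=> a u v /asboolP Xu /asboolP Xv; apply/asboolP; apply: XD.
move=> u v /asboolP Xuv; apply/orP.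
have [Xu|/ext[a [x [Xx Mu]]]] := pselect (X u); first by left; apply/asboolP.
have [Xv|/ext[b [y [Xy Mv]]]] := pselect (X v); first by right; apply/asboolP.
exfalso; apply: (XM _ _ (MM _ _ Mu Mv)).
have ->: (a * u + x) * (b * v + y) = (a * b) * (u * v) + ((b * v + y) * x + (a * u) * y) by ring.
by apply: (XD) => //; apply: (XD) => //; apply: XA.
Qed.

(** Otherwise some prime over [G] avoids every [c ^+ n * u] with [u] outside [P];
    it lies in [P] and misses [c], against minimality. *)
Lemma minimal_prime_torsion (R : comNzRingType) (P : {pred R}) (G c : R) :
  prime_ideal P -> G \in P ->
  (forall Q : {pred R}, prime_ideal Q -> G \in Q -> {subset Q <= P} -> {subset P <= Q}) ->
  c \in P -> exists n u g, u \notin P /\ c ^+ n * u = G * g.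
Proof.
move=> Pp PG minP Pc; apply: contrapT => noT.
have [||||x [g ->]|Q Qp [QG QM]] := @prime_avoiding R (fun x => exists g, x = G * g)
  (fun x => exists n u, u \notin P /\ x = c ^+ n * u).
- by exists 0; rewrite mulr0.
- by move=> a _ _ [g ->] [g' ->]; exists (a * g + g'); ring.
- by exists 0%N, 1; rewrite prime1 // expr0 mulr1.
- move=> _ _ [n [u [Pu ->]]] [m [w [Pw ->]]]; exists (n + m)%N, (u * w).
  by rewrite primeM // negb_or Pu; split=> //; rewrite exprD; ring.
- by move=> [n [u [Pu E]]]; apply: noT; exists n, u, g.
have QP : {subset Q <= P}.
  move=> x Qx; apply: contraT => Px; case: (QM x Qx).
  by exists 0%N, x; rewrite expr0 mul1r.
apply: (QM c); first by apply: (minP Q) => //; apply: QG; exists 1; rewrite mulr1.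
by exists 1%N, 1; rewrite prime1 // mulr1.
Qed.

(** * Primes of polynomial rings in one and two variables *)

Section Contraction.
Variable R : idomainType.
Implicit Types P Q : {pred {poly R}}.

(** A prime of R[X] that is not extended from R cannot grow without its contraction
    growing. Take [G] in [P] with leading coefficient outside [P] and [h] in [Q] outside
    [P], both of minimal degree. Pseudo-dividing [h] by [G] shows that [h] has smaller
    degree than [G]; pseudo-dividing [G] by [h] then gives a quotient in [P] that
    contradicts the choice of [G], unless [h] is a constant. *)
Lemma prime_poly_contraction P Q (G h : {poly R}) :
  prime_ideal P -> prime_ideal Q -> {subset P <= Q} ->
  h \in Q -> h \notin P -> G \in P -> (lead_coef G)%:P \notin P ->
  exists c : R, c%:P \in Q /\ c%:P \notin P.
Proof.
move=> Pp Qp PQ Qh0 Ph0 PG0 lG0.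
have [{lG0 PG0}G [[PG lG] minG]] :
    exists G, (G \in P /\ (lead_coef G)%:P \notin P) /\
      forall K, K \in P /\ (lead_coef K)%:P \notin P -> (size G <= size K)%N.
  by apply: ex_min_measure; exists G.
have [{Qh0 Ph0}h [[Qh Ph] minh]] :
    exists h, (h \in Q /\ h \notin P) /\
      forall k, k \in Q /\ k \notin P -> (size h <= size k)%N.
  by apply: ex_min_measure; exists h.
have lX (K : {poly R}) n : (lead_coef K)%:P \notin P -> (lead_coef K ^+ n)%:P \notin P.
  by move=> lK; apply: contra lK; rewrite rmorphXn; apply: primeX.
have nz (K : {poly R}) : K \notin P -> K != 0.
  by apply: contraNneq => ->; rewrite prime0.
have G0 : G != 0 by rewrite -lead_coef_eq0 -polyC_eq0 nz.
have h0 := nz _ Ph.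
(* Otherwise the leading term could be removed from h. *)
have lh : (lead_coef h)%:P \notin P.
  apply/negP => Plh.
  suff: (size h <= size (h - lead_coef h *: 'X^((size h).-1))%R)%N.
    rewrite leqNgt => /negP; apply.
    rewrite -[X in (_ < X)%N]prednK ?size_poly_gt0 // ltnS.
    apply/leq_sizeP => j; rewrite coefB coefZ coefXn.
    rewrite leq_eqVlt => /predU1P[<-|ltj]; first by rewrite eqxx mulr1 lead_coefE subrr.
    rewrite gtn_eqF // mulr0 subr0 nth_default //.
    by move: ltj; case: (size h).
  apply: minh.
  have -> : lead_coef h *: 'X^((size h).-1) = 'X^((size h).-1) * (lead_coef h)%:P.
    by rewrite mulrC mul_polyC.
  have Pl : 'X^((size h).-1) * (lead_coef h)%:P \in P by apply: primeMl.
  split; first by rewrite primeB // PQ.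
  apply: contra Ph => Pd; rewrite -(subrK ('X^((size h).-1) * (lead_coef h)%:P) h).
  exact: primeD.
have hG : (size h < size G)%N.
  have := Pdiv.Idomain.divp_eq h G; set k := scalp h G => eq_h.
  apply: leq_ltn_trans (minh (h %% G) _) (ltn_modpN0 _ G0).
  have -> : h %% G = (lead_coef G ^+ k)%:P * h - h %/ G * G.
    by rewrite mul_polyC eq_h addrC addKr.
  split; first by apply: primeB => //; [exact: primeMl|exact/PQ/primeMl].
  apply: contra Ph => Pr; have : (lead_coef G ^+ k)%:P * h \in P.
    by rewrite -(subrK (h %/ G * G) (_ * h)) primeD // primeMl.
  by rewrite primeM // (negPf (lX _ _ lG)).
have [size_h|size_h] := leqP (size h) 1.
  by exists h`_0; rewrite -size1_polyC.
have eqG := Pdiv.Idomain.divp_eq G h; set k := scalp G h in eqG.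
have Pr : G %% h \in P.
  apply: contraT => Pr; have := ltn_modpN0 G h0; rewrite ltnNge minh //; split=> //.
  have -> : G %% h = (lead_coef h ^+ k)%:P * G - G %/ h * h.
    by rewrite mul_polyC eqG addrC addKr.
  by apply: primeB => //; [exact/PQ/primeMl|exact: primeMl].
have Pq : G %/ h \in P.
  have : G %/ h * h \in P.
    have -> : G %/ h * h = (lead_coef h ^+ k)%:P * G - G %% h.
      by rewrite mul_polyC eqG addrK.
    by apply: primeB => //; exact: primeMl.
  by rewrite primeM // (negPf Ph) orbF.
have szqh : (size (G %% h)%R < size (G %/ h * h)%R)%N.
  rewrite (leq_trans (ltn_modpN0 _ h0)) // size_mul ?(negPf h0) //.
    rewrite -ltnS prednK ?addn_gt0 ?size_poly_gt0 ?h0 ?orbT //.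
    rewrite -[ltnLHS]add0n ltn_add2r size_poly_gt0 divpN0 //.
    exact: ltnW.
  by rewrite divpN0 // ltnW.
have lq : lead_coef (G %/ h) * lead_coef h = lead_coef h ^+ k * lead_coef G.
  by rewrite -lead_coefM -lead_coefZ eqG lead_coefDl.
have q0 : G %/ h != 0 by rewrite divpN0 // ltnW.
suff: (size G <= size (G %/ h)%R)%N.
  have : size (lead_coef h ^+ k *: G) = size (G %/ h * h) by rewrite eqG size_polyDl.
  rewrite size_scale ?expf_neq0 ?lead_coef_eq0 // size_mul // => ->.
  by move: size_h; case: (size h) => [|[|n]] // _; rewrite !addnS /= leqNgt ltnS leq_addr.
apply: minG; split=> //; apply/negP => Plq.
have : (lead_coef h ^+ k * lead_coef G)%:P \in P by rewrite -lq rmorphM primeMr.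
by rewrite rmorphM primeM // (negPf lG) (negPf (lX _ _ lh)).
Qed.

End Contraction.

Section PlaneCurve.
Variable F : fieldType.
Local Notation R2 := {poly {poly F}}.
Implicit Types P Q : {pred R2}.

Lemma prime_nonzero_const P (c : F) : prime_ideal P -> c != 0 -> c%:P%:P \notin P.
Proof.
move=> Pp c0; apply/negP => Pc; have := prime1 Pp.
rewrite -[1]polyC1 -[1]polyC1 -(divff c0) polyCM polyCM mulrC.
by rewrite primeMl.
Qed.

(** Exchanging the two variables lets every statement about F[Y] be used for F[X]. *)
Lemma prime_swap P : prime_ideal P -> prime_ideal [pred x : R2 | swapXY x \in P].
Proof. exact: (@prime_preim R2 R2 (@swapXY F) P). Qed.

Definition meets_base P := exists2 c : {poly F}, c != 0 & c%:P \in P.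

Lemma meets_base_of_chain P Q (G h : R2) :
  prime_ideal P -> prime_ideal Q -> {subset P <= Q} ->
  h \in Q -> h \notin P -> G \in P -> G != 0 -> meets_base Q.
Proof.
move=> Pp Qp PQ Qh Ph PG G0.
have [PlG|PlG] := boolP ((lead_coef G)%:P \in P).
  by exists (lead_coef G); rewrite ?lead_coef_eq0 // PQ.
have [c [Qc Pc]] := prime_poly_contraction Pp Qp PQ Qh Ph PG PlG.
by exists c => //; apply: contraNneq Pc => ->; rewrite polyC0 prime0.
Qed.

(** The Krull dimension of F[X, Y] / (G) is at most 1. The middle prime contains a
    nonzero polynomial in Y alone and one in X alone ([meets_base_of_chain], used twice).
    As the latter has a constant leading coefficient, a strict inclusion of the middle
    prime in the last one would be visible in F[Y], and from there, by the same
    argument, in F, which is absurd. *)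
Lemma no_prime_chain3 P0 P1 P2 (G h1 h2 : R2) :
  prime_ideal P0 -> prime_ideal P1 -> prime_ideal P2 ->
  {subset P0 <= P1} -> {subset P1 <= P2} -> G \in P0 -> G != 0 ->
  h1 \in P1 -> h1 \notin P0 -> h2 \in P2 -> h2 \in P1.
Proof.
move=> P0p P1p P2p P01 P12 PG G0 P1h1 P0h1 P2h2; apply: contraT => P1h2.
have [c2 c2_neq0 P1c2] := meets_base_of_chain P0p P1p P01 P1h1 P0h1 PG G0.
have [c3 c3_neq0 P1c3] : meets_base [pred x : R2 | swapXY x \in P1].
  apply: (@meets_base_of_chain [pred x : R2 | swapXY x \in P0] _ (swapXY G) (swapXY h1));
    rewrite ?inE ?swapXYK ?swapXY_eq0 //; try exact: prime_swap.
  by move=> x; rewrite !inE => /P01.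
rewrite inE swapXY_polyC in P1c3.
have [|c [P2c P1c]] := prime_poly_contraction P1p P2p P12 P2h2 P1h2 P1c3.
  by rewrite lead_coef_map_inj ?polyC0 //; [apply: prime_nonzero_const; rewrite ?lead_coef_eq0|exact: polyC_inj].
have [||||k [P2k P1k]] := @prime_poly_contraction F [pred x : {poly F} | x%:P \in P1]
  [pred x : {poly F} | x%:P \in P2] c2 c _ _ _ P2c P1c P1c2.
- exact: (prime_preim (@polyC {poly F})).
- exact: (prime_preim (@polyC {poly F})).
- by move=> x; rewrite !inE => /P12.
- by rewrite inE prime_nonzero_const ?lead_coef_eq0.
rewrite !inE in P2k P1k; have [k0|k0] := eqVneq k 0.
  by rewrite k0 !polyC0 prime0 in P1k.
by rewrite (negPf (prime_nonzero_const P2p k0)) in P2k.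
Qed.

(** The Rabinowitsch trick. Let [G] in [P] have minimal degree in X and leading
    coefficient g in F[Y]. Modulo [P], every b becomes after multiplication by a power of
    g a polynomial r of smaller degree, so an inverse b of some h in F[Y] would give
    h r = g^k exactly, hence h would divide g^k. Choosing h prime to g excludes this. *)
Lemma not_maximal_base P (G : R2) :
  prime_ideal P -> G \in P -> G != 0 -> ~ meets_base P ->
  exists h : R2, h \notin P /\ forall b, 1 - h * b \notin P.
Proof.
move=> Pp PG0 G0 nP.
have Pc (c : {poly F}) : c%:P \in P -> c = 0.
  by move=> Pc; apply: contra_notP nP => /eqP c0; exists c.
have [{G0 PG0}G [[PG G0] minG]] : exists G : R2, (G \in P /\ G != 0) /\
    forall K : R2, K \in P /\ K != 0 -> (size G <= size K)%N.
  by apply: ex_min_measure; exists G.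
set g := lead_coef G; have g0 : g != 0 by rewrite lead_coef_eq0.
have sG : (1 < size G)%N.
  rewrite ltnNge; apply/negP => sG; have GE := size1_polyC sG.
  by move: G0; rewrite GE polyC_eq0 (Pc G`_0) ?eqxx // -GE.
have sXg : size ('X * g) = (size g).+1 by rewrite mulrC size_mulX.
(* This h is coprime to g and, as g is not zero, not constant. *)
set h : {poly F} := 1 + 'X * g.
have sh : (1 < size h)%N.
  by rewrite /h addrC size_polyDl sXg ?size_poly1 ltnS size_poly_gt0.
exists h%:P; split.
  by apply/negP => /Pc h0; rewrite h0 size_poly0 in sh.
move=> b; apply/negP => Pb; have eqb := Pdiv.Idomain.divp_eq b G.
set k := scalp b G in eqb; set r := b %% G in eqb.
have rG : (size r < size G)%N by apply: ltn_modpN0.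
have Pd : h%:P * r - (g ^+ k)%:P \in P.
  have -> : h%:P * r - (g ^+ k)%:P = - ((g ^+ k)%:P * (1 - h%:P * b)) - h%:P * (b %/ G) * G.
    have -> : r = (g ^+ k)%:P * b - (b %/ G) * G by rewrite mul_polyC eqb addrC addKr.
    by move: (g ^+ k)%:P h%:P (b %/ G) => /= x y z; ring.
  by apply: primeB => //; [apply: primeN|]; rewrite ?primeMl.
have eq_hr : h%:P * r = (g ^+ k)%:P.
  apply/eqP; rewrite -subr_eq0; apply: contraT => d0.
  have := minG _ (conj Pd d0); rewrite leqNgt (leq_ltn_trans (size_polyD _ _)) //.
  rewrite gtn_max mul_polyC (leq_ltn_trans (size_scale_leq _ _)) // size_polyN.
  by rewrite (leq_ltn_trans (size_polyC_leq1 _)).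
have : h %| g ^+ k.
  apply/dvdpP; exists r`_0; move/(congr1 (fun q : R2 => q`_0)): eq_hr.
  by rewrite coefCM coefC eqxx mulrC => <-.
have cop : coprimep h (g ^+ k).
  apply: coprimep_expr; rewrite /h coprimep_sym addrC.
  by rewrite coprimep_addl_mul coprimep1.
move=> hdvd; move: sh; have : coprimep h h by apply: coprimep_dvdl hdvd cop.
by rewrite coprimepp => /eqP ->.
Qed.

(** A polynomial in X and one in Y are coprime. Reducing the coefficients of [g]
    modulo [c] leaves a remainder whose leading coefficient has degree less than [c]
    and yet is divisible by [c]. *)
Lemma base_dvd (c d : {poly F}) (g g' : R2) : c != 0 -> d != 0 ->
  (map_poly polyC d) * g = c%:P * g' -> exists g1, g = c%:P * g1.
Proof.
move=> c0 d0 E.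
pose g1 : R2 := map_poly (fun q => q %/ c) g; pose r : R2 := map_poly (fun q => q %% c) g.
have gE : g = c%:P * g1 + r.
  apply/polyP => i; rewrite coefD coefCM !coef_map_id0 ?div0p ?mod0p //.
  by rewrite mulrC -divp_eq.
suff r0 : r = 0 by exists g1; rewrite gE r0 addr0.
apply/eqP; apply: contraT => r0.
have : c %| lead_coef (map_poly polyC d * r).
  have -> : map_poly polyC d * r = c%:P * (g' - map_poly polyC d * g1).
    by rewrite mulrBr -E gE; ring.
  by rewrite lead_coefM lead_coefC dvdp_mulr.
rewrite lead_coefM lead_coef_map_inj ?polyC0 //; last exact: polyC_inj.
rewrite mul_polyC dvdpZr ?lead_coef_eq0 // => dv.
have : (size (lead_coef r) < size c)%N.
  by rewrite lead_coefE coef_map_id0 ?mod0p // ltn_modp.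
by rewrite ltnNge dvdp_leq // lead_coef_eq0.
Qed.

(** The components of a plane curve have dimension at least 1. If [P] contains no
    nonzero polynomial in Y alone, or none in X alone, [not_maximal_base] gives an element
    that is not invertible modulo [P], hence a larger prime. If [P] contains c(Y) and
    d(X), a power of each is killed modulo [G] by elements outside [P]
    ([minimal_prime_torsion]); c and d being coprime, a common multiple of these
    elements is divisible by [G] and so lies in [P], which is absurd. *)
Lemma minimal_prime_extends P (G : R2) :
  G != 0 -> prime_ideal P -> G \in P ->
  (forall Q, prime_ideal Q -> G \in Q -> {subset Q <= P} -> {subset P <= Q}) ->
  exists2 Q, prime_ideal Q & {subset P <= Q} /\ ~ {subset Q <= P}.
Proof.
move=> G0 Pp PG minP.
have ext : (exists h : R2, h \notin P /\ forall b, 1 - h * b \notin P) ->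
    exists2 Q, prime_ideal Q & {subset P <= Q} /\ ~ {subset Q <= P}.
  move=> [h [Ph hP]].
  have [|||||Q Qp [QJ _]] := @prime_avoiding R2 (fun x => exists b a, a \in P /\ x = a + h * b) (eq 1).
  - by exists 0, 0; rewrite prime0 // mulr0 addr0.
  - move=> a _ _ [b [x [Px ->]]] [b' [x' [Px' ->]]].
    exists (a * b + b'), (a * x + x'); split; last by ring.
    by apply: primeD => //; apply: primeMl.
  - by [].
  - by move=> _ _ <- <-; rewrite mulr1.
  - move=> _ [b [a [Pa ->]]] E; have := hP b.
    by rewrite E addrK Pa.
  exists Q => //; split=> [x Px|/(_ h)QP].
    by apply: QJ; exists 0, x; rewrite mulr0 addr0.
  by move: Ph; rewrite QP // QJ //; exists 1, 0; rewrite prime0 // mulr1 add0r.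
have [[c c0 Pc]|/(not_maximal_base Pp PG G0)] := pselect (meets_base P); last exact: ext.
have [[d d0 Pd]|] := pselect (meets_base [pred x : R2 | swapXY x \in P]); last first.
  move/(@not_maximal_base _ (swapXY G) (prime_swap Pp)).
  rewrite inE swapXYK swapXY_eq0 => /(_ PG G0)[h [Ph hP]].
  apply: ext; exists (swapXY h); split=> // b.
  by have := hP (swapXY b); rewrite inE rmorphB rmorphM rmorph1 /= swapXYK.
rewrite inE swapXY_polyC in Pd.
have [n [u [g [Pu Eu]]]] := minimal_prime_torsion Pp PG minP Pc.
have [m [w [g' [Pw Ew]]]] := minimal_prime_torsion Pp PG minP Pd.
have E : map_poly polyC (d ^+ m) * (g * w) = (c ^+ n)%:P * (g' * u).
  apply: (mulfI G0); rewrite !rmorphXn /=.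
  transitivity (c%:P ^+ n * u * (map_poly polyC d ^+ m * w)); last by rewrite Ew; ring.
  by rewrite Eu; ring.
have [||g1 Eg1] := base_dvd _ _ E; rewrite ?expf_neq0 //.
have : u * w = G * g1.
  have /mulfI : (c ^+ n)%:P != 0 :> R2 by rewrite polyC_eq0 expf_neq0.
  by apply; rewrite mulrA [in LHS]rmorphXn /= Eu -mulrA Eg1; ring.
move=> Euw; have : u * w \in P by rewrite Euw primeMr.
by rewrite primeM // (negPf Pu) (negPf Pw).
Qed.

End PlaneCurve.

(** * Polynomials in three variables *)

Lemma inord3_neq : ((i0 == i1) = false) * ((i0 == i2) = false) * ((i1 == i0) = false)
  * ((i1 == i2) = false) * ((i2 == i0) = false) * ((i2 == i1) = false).
Proof. by rewrite -!val_eqE /= !inordK. Qed.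

Lemma ord3_ind (Q : 'I_3 -> Prop) : Q i0 -> Q i1 -> Q i2 -> forall i, Q i.
Proof.
move=> Q0 Q1 Q2 i; have -> : i = inord i by rewrite inord_val.
by case: i => -[|[|[|]]].
Qed.

Lemma big_ord3 (R : Type) (idx : R) (op : Monoid.law idx) (G : 'I_3 -> R) :
  \big[op/idx]_(i < 3) G i = op (op (G i0) (G i1)) (G i2).
Proof.
rewrite !big_ord_recl big_ord0 Monoid.mulm1 Monoid.mulmA.
by congr (op (op (G _) (G _)) (G _)); apply/val_inj; rewrite /= inordK.
Qed.

Section MPolyInduction.
Variables (n : nat) (R : comNzRingType) (Q : {mpoly R[n]} -> Prop).
Hypotheses (QC : forall c, Q c%:MP) (QX : forall i, Q 'X_i).
Hypotheses (QD : forall g h, Q g -> Q h -> Q (g + h)).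
Hypotheses (QM : forall g h, Q g -> Q h -> Q (g * h)).

(** Polynomial identities between ring morphisms or derivations are checked on the
    variables by means of this principle. *)
Lemma mpoly_ring_ind g : Q g.
Proof.
elim/mpolyind: g => [|c m g _ _ IHg]; first by rewrite -mpolyC0.
apply: QD => //; rewrite -mul_mpolyC; apply: QM => //.
have Q1 : Q 1 by rewrite -mpolyC1.
rewrite mpolyXE_id; apply: (big_ind Q) => // i _.
by elim: (m i) => [|k IHk]; rewrite ?expr0 // exprS; apply: QM.
Qed.
End MPolyInduction.

(** * Curves that are graphs over a plane curve *)

Section Curve.
Variable F : fieldType.
Local Notation S := {mpoly F[3]}.
Local Notation R2 := {poly {poly F}}.
Local Notation t1 := ('X_i0 : S).
Local Notation t2 := ('X_i1 : S).
Local Notation t3 := ('X_i2 : S).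

Lemma ideal_gen2P (g h x : S) :
  ideal_gen [tuple g; h] x <-> exists a b, x = a * g + b * h.
Proof.
split=> [[c ->]|[a [b ->]]].
  by exists (c ord0), (c (lift ord0 ord0)); rewrite !big_ord_recl big_ord0 addr0.
exists (fun i => [:: a; b]`_i); by rewrite !big_ord_recl big_ord0 addr0.
Qed.

Lemma ideal_gen1P (h x : S) : ideal_gen [tuple h] x <-> exists a, x = a * h.
Proof.
split=> [[c ->]|[a ->]]; first by exists (c ord0); rewrite big_ord_recl big_ord0 addr0.
by exists (fun=> a); rewrite big_ord_recl big_ord0 addr0.
Qed.

Section Bivariate.

Definition of_base : {poly F} -> S := horner_eval t2 \o map_poly (@mpolyC 3 F).
HB.instance Definition _ := GRing.RMorphism.on of_base.
(** The inclusion of F[t2, t3] in F[t1, t2, t3], with t2 as the inner variable 'Y and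
    t3 as the outer variable 'X. *)
Definition of_bivariate : R2 -> S := horner_eval t3 \o map_poly of_base.
HB.instance Definition _ := GRing.RMorphism.on of_bivariate.

Lemma of_bivariateX : of_bivariate 'X = t3.
Proof. by rewrite /of_bivariate /= map_polyX /horner_eval hornerX. Qed.
Lemma of_bivariateY : of_bivariate 'Y = t2.
Proof.
by rewrite /of_bivariate /= map_polyC /= /of_base /= map_polyX /horner_eval hornerC hornerX.
Qed.
Lemma of_bivariateC c : of_bivariate c%:P%:P = c%:MP.
Proof. by rewrite /of_bivariate /= map_polyC /= /of_base /= map_polyC /horner_eval !hornerC. Qed.

Definition subst_t1 (b : R2) : S -> R2 :=
  mmap (polyC \o polyC) (fun i => [tuple b; 'Y; 'X]`_i).
HB.instance Definition _ b := GRing.RMorphism.on (subst_t1 b).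

Lemma subst_t1C b c : subst_t1 b c%:MP = c%:P%:P.
Proof. exact: mmapC. Qed.
Lemma subst_t1X b i : subst_t1 b 'X_i = [tuple b; 'Y; 'X]`_i.
Proof. by rewrite /subst_t1 mmapX mmap1U. Qed.

Definition t1_free (g : S) := forall m, m \in msupp g -> m i0 = 0%N.

Lemma of_bivariate_subst_t1 g : t1_free g -> of_bivariate (subst_t1 0 g) = g.
Proof.
move=> g_free; rewrite [in RHS](mpolyE g) /subst_t1 /mmap rmorph_sum.
apply: eq_big_seq => m /g_free m0; rewrite -mul_mpolyC rmorphM /= of_bivariateC.
congr (_ * _); rewrite mpolyXE_id rmorph_prod; apply: eq_bigr => i _.
rewrite rmorphXn; move: i; apply: ord3_ind; rewrite inordK //=.
- by rewrite m0 !expr0.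
- by rewrite of_bivariateY.
- by rewrite of_bivariateX.
Qed.
End Bivariate.

(** Modulo A - 1 the second equation reads t1 = - B. So substituting - B for t1 and
    the inclusion of F[t2, t3] are inverse to each other modulo the ideals, and primes
    over (A - 1, t1 A + B) correspond to primes over A - 1 in F[t2, t3], where
    [minimal_prime_extends] and [no_prime_chain3] apply. *)
Lemma is_curve_graph (A B : S) : t1_free A -> t1_free B -> A != 1 ->
  ~ ideal_gen [tuple A - 1; t1 * A + B] 1 ->
  is_curve (ideal_gen [tuple A - 1; t1 * A + B]).
Proof.
move=> A_free B_free A1 I1; split=> // P [Pp minP].
set I := ideal_gen _ in I1 Pp minP.
pose phi : {rmorphism R2 -> S} := of_bivariate; pose A' := subst_t1 0 A; pose B' := subst_t1 0 B.
have phiA : phi A' = A by apply: of_bivariate_subst_t1.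
have phiB : phi B' = B by apply: of_bivariate_subst_t1.
pose pi : {rmorphism S -> R2} := subst_t1 (- B').
have piC c : pi c%:MP = c%:P%:P by apply: subst_t1C.
have piX i : pi 'X_i = [tuple - B'; 'Y; 'X]`_i by apply: subst_t1X.
have phiC c : phi c%:P%:P = c%:MP by apply: of_bivariateC.
have phiX : phi 'X = t3 by apply: of_bivariateX.
have phiY : phi 'Y = t2 by apply: of_bivariateY.
have phi_pi g : I (phi (pi g) - g).
  apply/ideal_gen2P; elim/mpoly_ring_ind: g => [c|i|g h [a [b E]] [a' [b' E']]|g h [a [b E]] [a' [b' E']]].
  - by exists 0, 0; rewrite piC phiC; ring.
  - move: i; apply: ord3_ind; rewrite piX inordK //=.
    + by exists t1, (-1); rewrite rmorphN /= phiB; ring.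
    + by exists 0, 0; rewrite phiY; ring.
    + by exists 0, 0; rewrite phiX; ring.
  - exists (a + a'), (b + b'); rewrite !rmorphD /=.
    by transitivity ((phi (pi g) - g) + (phi (pi h) - h)); [ring|rewrite E E'; ring].
  - exists (phi (pi g) * a' + a * h), (phi (pi g) * b' + b * h); rewrite !rmorphM /=.
    transitivity (phi (pi g) * (phi (pi h) - h) + (phi (pi g) - g) * h); first by ring.
    by rewrite E E'; ring.
have pi_phi x : pi (phi x) = x.
  elim/poly_ind: x => [|x c IHx]; first by rewrite !rmorph0.
  rewrite !rmorphD !rmorphM /= IHx phiX piX inordK //=; congr (_ + _).
  elim/poly_ind: c {x IHx} => [|c d IHc]; first by rewrite !rmorph0.
  rewrite polyCD polyCM !rmorphD !rmorphM /= IHc phiY phiC piC piX.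
  by rewrite inordK.
pose G := A' - 1.
have G0 : G != 0.
  rewrite subr_eq0; apply: contraNneq A1 => A'1; by rewrite -phiA A'1 rmorph1.
have piI g : I g -> exists h, pi g = G * h.
  case/ideal_gen2P=> a [b ->].
  have piA : pi A = A' by rewrite -phiA pi_phi.
  have piB : pi B = B' by rewrite -phiB pi_phi.
  exists (pi a - B' * pi b); rewrite !(rmorphD, rmorphM, rmorphN) rmorph1 piA piB.
  by rewrite piX inordK //= /G; ring.
have phiG : I (phi G).
  by apply/ideal_gen2P; exists 1, 0; rewrite rmorphB rmorph1 phiA; ring.
have pull Q : prime_over I Q ->
    [/\ prime_ideal [pred x | phi x \in Q], G \in [pred x | phi x \in Q]
      & forall g, (pi g \in [pred x | phi x \in Q]) = (g \in Q)].
  case=> Qi Qp IQ; have Qpr : prime_ideal Q by [].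
  split; first exact: (@prime_preim R2 S phi Q).
    by rewrite inE IQ.
  by move=> g; rewrite inE; apply: prime_congr => //; apply: IQ.
have push (Q : {pred R2}) : prime_ideal Q -> G \in Q ->
    prime_over I [pred g | pi g \in Q].
  move=> Qp QG; have [Q1 Q2] := @prime_preim S R2 pi Q Qp.
  by split=> // g /piI[h E]; rewrite inE E primeMr.
have minP' (Q : {pred R2}) : prime_ideal Q -> G \in Q ->
    {subset Q <= [pred x | phi x \in P]} -> {subset [pred x | phi x \in P] <= Q}.
  move=> Qp QG QP x; rewrite inE => Px; rewrite -(pi_phi x).
  apply: (minP _ (push Q Qp QG)) => // g; rewrite inE => /QP.
  by have [_ _ ->] := pull P Pp.
split.
  have [Pp' PG Ppi] := pull P Pp.
  have [Q Qp [PQ QP]] := minimal_prime_extends G0 Pp' PG minP'.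
  have QG : G \in Q by apply: PQ.
  exists (fun i => if i is 0%N then P else [pred g | pi g \in Q]); split.
    case=> [|i] _; first by have [? ? ?] := Pp; split.
    have [Q1 Q2 Q3] := push Q Qp QG; split=> // g Pg.
    by rewrite inE PQ // Ppi.
  case=> // _; split=> [g Pg|QP']; first by rewrite inE PQ // Ppi.
  by apply: QP => x Qx; rewrite inE; apply: QP'; rewrite inE pi_phi.
case=> Q [Qpr Qlt].
have QI i : (i <= 2)%N -> prime_over I (Q i).
  move=> /Qpr[Q1 Q2 QP]; split=> // g Ig; apply: QP; by have [_ _ IP] := Pp; apply: IP.
have [Q0p Q0G Q0pi] := pull _ (QI 0%N isT).
have [Q1p Q1G Q1pi] := pull _ (QI 1%N isT).
have [Q2p Q2G Q2pi] := pull _ (QI 2%N isT).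
have [Q01 Q10] := Qlt 0%N isT; have [Q12 Q21] := Qlt 1%N isT.
have [h1 [Q1h1 Q0h1]] : exists h, h \in Q 1%N /\ h \notin Q 0%N.
  apply: contra_notP Q10 => nh g Q1g; apply: contraT => Q0g; case: nh; by exists g.
apply: Q21 => h2 Q2h2; rewrite -Q1pi.
apply: (no_prime_chain3 (h1 := pi h1) Q0p Q1p Q2p _ _ Q0G G0) => [x|x|||].
- by rewrite !inE => /Q01.
- by rewrite !inE => /Q12.
- by rewrite (Q1pi h1).
- by rewrite (Q0pi h1).
- by rewrite (Q2pi h2).
Qed.
End Curve.

(** * Derivations in characteristic p *)

Definition derivation (R : comNzRingType) (D : R -> R) : Prop :=
  {morph D : x y / x + y} /\ forall x y, D (x * y) = D x * y + x * D y.

Section Derivation.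
Variables (R : comNzRingType) (D : R -> R).
Hypothesis dD : derivation D.

Lemma derivationD : {morph D : x y / x + y}. Proof. by case: dD. Qed.
Lemma derivationM x y : D (x * y) = D x * y + x * D y. Proof. by case: dD. Qed.
Lemma derivation0 : D 0 = 0.
Proof. by apply: (addrI (D 0)); rewrite -derivationD !addr0. Qed.
Lemma derivationN x : D (- x) = - D x.
Proof. by apply: (addrI (D x)); rewrite -derivationD !subrr derivation0. Qed.
Lemma derivationB x y : D (x - y) = D x - D y.
Proof. by rewrite derivationD derivationN. Qed.
Lemma derivation1 : D 1 = 0.
Proof.
by apply: (addrI (D 1)); rewrite addr0 -[in RHS](mulr1 1) derivationM mulr1 mul1r.
Qed.
Lemma derivationMn x n : D (x *+ n) = D x *+ n.
Proof. by elim: n => [|n IHn]; rewrite ?mulr0n ?derivation0 // !mulrS derivationD IHn. Qed.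
Lemma derivation_nat n : D n%:R = 0.
Proof. by rewrite derivationMn derivation1 mul0rn. Qed.
Lemma derivationX x n : D (x ^+ n) = n%:R * x ^+ n.-1 * D x.
Proof.
case: n => [|n]; first by rewrite derivation1 !mul0r.
elim: n => [|n IHn]; first by rewrite !expr0 expr1 !mul1r.
rewrite exprS derivationM IHn /= [in RHS]mulrS exprS.
by move: (x ^+ n) (n.+1%:R) (D x) => y z w; ring.
Qed.
Lemma derivation_natM n x : D (n%:R * x) = n%:R * D x.
Proof. by rewrite derivationM derivation_nat mul0r add0r. Qed.

Lemma derivation_iterD n : {morph iter n D : x y / x + y}.
Proof. by elim: n => [|n IHn] x y //=; rewrite IHn derivationD. Qed.

Lemma derivation_Leibniz n x y : iter n D (x * y) =
  \sum_(i < n.+1) (iter (n - i) D x * iter i D y) *+ 'C(n, i).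
Proof.
elim: n => [|n IHn]; first by rewrite big_ord_recl big_ord0 addr0 bin0.
have Dsum m (G : 'I_m -> R) : D (\sum_i G i) = \sum_i D (G i).
  by apply: (big_morph D) => [u w|]; rewrite ?derivationD ?derivation0.
rewrite iterS IHn Dsum.
under eq_bigr => i _ do rewrite derivationMn derivationM mulrnDl.
rewrite big_split /= [RHS]big_ord_recl [X in X + _ = _]big_ord_recl [X in _ + X = _]big_ord_recr /=.
rewrite !bin0 !subn0 -!addrA; congr (_ + _); rewrite subnn.
rewrite [RHS]big_ord_recr /= /bump /= !add1n subnn !binn addrA; congr (_ + _).
rewrite -big_split; apply: eq_bigr => i _ /=; rewrite /bump /= !add1n binS mulrnDr subSS.
by rewrite -iterS subnSK.
Qed.

(** In the Leibniz formula the binomial coefficients other than the first and the last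
    vanish. *)
Lemma derivation_iter_pchar p : p \in [pchar R] -> derivation (iter p D).
Proof.
move=> pR; split; first exact: derivation_iterD.
move=> x y; rewrite derivation_Leibniz.
have p_pr := pcharf_prime pR; case: p p_pr pR => // p p_pr pR.
rewrite big_ord_recl big_ord_recr /= bin0 /bump /= add1n subnn binn !mulr1n.
rewrite big1 ?add0r // => i _; rewrite /= /bump /= add1n -mulr_natr.
have /dvdnP[c ->] : (p.+1 %| 'C(p.+1, i.+1))%N by apply: prime_dvd_bin => //=; rewrite ltnS.
by rewrite natrM (pcharf0 pR) !mulr0.
Qed.

(** The extension of D to R[X] that kills X. *)
Definition coefwise (Q : {poly R}) : {poly R} := map_poly D Q.

Lemma coef_coefwise Q i : (coefwise Q)`_i = D Q`_i.
Proof. by rewrite coef_map_id0 ?derivation0. Qed.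

Lemma coefwise_derivation : derivation coefwise.
Proof.
split=> [Q Q'|Q Q']; apply/polyP => i.
  by rewrite coefD !coef_coefwise coefD derivationD.
rewrite coefD !coefM coef_coefwise coefM.
rewrite (big_morph D derivationD derivation0) -big_split; apply: eq_bigr => j _.
by rewrite derivationM !coef_coefwise.
Qed.

Lemma coefwiseC c : coefwise c%:P = (D c)%:P.
Proof. by apply/polyP => i; rewrite coef_coefwise !coefC; case: eqP; rewrite ?derivation0. Qed.

Lemma coefwiseX : coefwise 'X = 0.
Proof. by apply/polyP => i; rewrite coef_coefwise coefX coef0 derivation_nat. Qed.

End Derivation.

(** * The Ramanujan vector field *)

Section Ramanujan.
Variable F : fieldType.
Local Notation S := {mpoly F[3]}.
Local Notation t1 := ('X_i0 : S).
Local Notation t2 := ('X_i1 : S).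
Local Notation t3 := ('X_i2 : S).
Local Notation v := (@ramanujan F).
Local Notation d1 := (mderiv i0).

Definition inv12 : S := (1 / 12%:R)%:MP.
Local Notation k := inv12.

(** The Euler field of the weighted grading; together with v and the derivative in t1
    it spans a copy of sl2. *)
Definition euler (g : S) : S :=
  2%:R * t1 * mderiv i0 g + 4%:R * t2 * mderiv i1 g + 6%:R * t3 * mderiv i2 g.

Lemma mderiv_derivation i : derivation (@mderiv 3 F i).
Proof. by split=> x y; [exact: mderivD|exact: mderivM]. Qed.

Lemma mderivXU (i j : 'I_3) : mderiv i 'X_j = (i == j)%:R :> S.
Proof.
rewrite mderivX mnm1E eq_sym; case: eqP => [->|_]; last by rewrite scale0r.
rewrite scale1r (_ : (_ - _)%MM = 0%MM) ?mpolyX0 //.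
by apply/mnmP => l; rewrite mnmBE subnn mnm0E.
Qed.

Hypothesis two_neq0 : 2%:R != 0 :> F.
Hypothesis three_neq0 : 3%:R != 0 :> F.

Lemma twelve_neq0 : 12%:R != 0 :> F.
Proof. by rewrite (natrM _ 4 3) (natrM _ 2 2) !mulf_neq0. Qed.

Lemma inv12E : 12%:R * k = 1.
Proof. by rewrite /inv12 -mpolyC_nat -mpolyCM mul1r divff ?twelve_neq0. Qed.

Lemma ramanujanE g : v g = (t1 ^+ 2 - k * t2) * mderiv i0 g
  + (4%:R * t1 * t2 - 6%:R * t3) * mderiv i1 g
  + (6%:R * t1 * t3 - 4%:R * k * t2 ^+ 2) * mderiv i2 g.
Proof.
have -> : 4%:R * k = (1 / 3%:R)%:MP.
  rewrite /inv12 -mpolyC_nat -mpolyCM; congr (_%:MP).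
  by field; rewrite twelve_neq0 three_neq0.
by rewrite /ramanujan -!mul_mpolyC.
Qed.

Lemma ramanujan_derivation : derivation v.
Proof.
by split=> x y; rewrite !ramanujanE ?mderivD ?mderivM; ring.
Qed.

Lemma euler_derivation : derivation euler.
Proof. by split=> x y; rewrite /euler ?mderivD ?mderivM; ring. Qed.

Lemma ramanujanC c : v c%:MP = 0.
Proof. by rewrite ramanujanE !mderivC !mulr0 !addr0. Qed.

Lemma eulerC c : euler c%:MP = 0.
Proof. by rewrite /euler !mderivC !mulr0 !addr0. Qed.

Lemma ramanujan_t1 : v t1 = t1 ^+ 2 - k * t2.
Proof. by rewrite ramanujanE !mderivXU !eqxx !inord3_neq /=; ring. Qed.
Lemma ramanujan_t2 : v t2 = 4%:R * t1 * t2 - 6%:R * t3.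
Proof. by rewrite ramanujanE !mderivXU !eqxx !inord3_neq /=; ring. Qed.
Lemma ramanujan_t3 : v t3 = 6%:R * t1 * t3 - 4%:R * k * t2 ^+ 2.
Proof. by rewrite ramanujanE !mderivXU !eqxx !inord3_neq /=; ring. Qed.

Lemma mderiv_inv12 i : mderiv i k = 0. Proof. exact: mderivC. Qed.

Lemma mderiv1_ramanujan g : d1 (v g) = v (d1 g) + euler g.
Proof.
have dM := mderiv_derivation.
rewrite !ramanujanE /euler !expr2.
rewrite !(mderivXU, mderiv_inv12, derivation_nat (dM _), derivation_natM (dM _),
  derivationB (dM _), mderivM, mderivD) !eqxx !inord3_neq /=.
rewrite (mderiv_comm i1 i0) (mderiv_comm i2 i0); ring.
Qed.

Lemma euler_ramanujan g : euler (v g) = v (euler g) + 2%:R * v g.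
Proof.
have dM := mderiv_derivation.
rewrite !ramanujanE /euler !expr2.
rewrite !(mderivXU, mderiv_inv12, derivation_nat (dM _), derivation_natM (dM _),
  derivationB (dM _), mderivM, mderivD) !eqxx !inord3_neq /=.
rewrite (mderiv_comm i1 i0) (mderiv_comm i2 i0) (mderiv_comm i2 i1); ring.
Qed.

(** The familiar commutator of a lowering operator with a power of a raising operator
    in sl2. For the p-th power it says that d/dt1 commutes with v^p. *)
Lemma mderiv1_iter_ramanujan n g :
  d1 (iter n.+1 v g) = iter n.+1 v (d1 g) + n.+1%:R * iter n v (euler g + n%:R * g).
Proof.
elim: n g => [|n IHn] g; first by rewrite /= mderiv1_ramanujan; ring.
have vD := ramanujan_derivation.
have itM m c h : iter m v (c%:R * h) = c%:R * iter m v h.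
  by elim: m => //= m ->; rewrite (derivation_natM vD).
rewrite iterSr IHn mderiv1_ramanujan euler_ramanujan.
have itD := derivation_iterD vD.
rewrite (itD n.+1 (v (d1 g))) (itD n (v (euler g) + _)) (itD n (v (euler g))).
rewrite (itD n.+1 (euler g)) !itM -!iterSr -[n.+2%:R]natr1 -[n.+1%:R]natr1.
by move: (iter _ v _) (iter _ v _) (iter _ v _) => x y z; ring.
Qed.

End Ramanujan.

(** * The first integrals as coefficients of a power of the Weierstrass cubic *)

Lemma deriv_derivation (R : comNzRingType) : derivation (@deriv R).
Proof. by split=> x y; [exact: derivD|exact: derivM]. Qed.

Section Weierstrass.
Variable F : fieldType.
Local Notation S := {mpoly F[3]}.
Local Notation t1 := ('X_i0 : S).
Local Notation t2 := ('X_i1 : S).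
Local Notation t3 := ('X_i2 : S).
Local Notation v := (@ramanujan F).
Local Notation k := (inv12 F).
Local Notation z := ('X - t1%:P : {poly S}).

(** The right-hand side of y^2 = P(x). Shifting x by t1 is what gives the Gauss-Manin
    connection along v the nilpotent form of [ramanujan_power] and [ramanujan_X_power]. *)
Definition weierstrass : {poly S} := 4%:R * z ^+ 3 - t2%:P * z - t3%:P.
Local Notation P := weierstrass.

Lemma coefwise_weierstrass (D : S -> S) : derivation D ->
  coefwise D P = (t2%:P - 12%:R * z ^+ 2) * (D t1)%:P - z * (D t2)%:P - (D t3)%:P.
Proof.
move=> dD; have dC := coefwise_derivation dD.
rewrite /weierstrass !(derivationB dC) (derivation_natM dC) (derivationX dC) (derivationM dC).
rewrite !(derivationB dC) (coefwiseX dD) !(coefwiseC dD) /=; ring.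
Qed.

Lemma deriv_weierstrass : P^`() = 12%:R * z ^+ 2 - t2%:P.
Proof.
rewrite /weierstrass !derivE; ring.
Qed.

Hypothesis two_neq0 : 2%:R != 0 :> F.
Hypothesis three_neq0 : 3%:R != 0 :> F.

(** With q this polynomial, the derivation v - q d/dx multiplies the cubic P by
    2 (x - q'), so it lifts v to the total space of the family y^2 = P. *)
Definition lift_coef : {poly S} := 2%:R * z ^+ 2 - 2%:R * t1%:P * z - t1%:P ^+ 2 - 3%:R * k%:P * t2%:P.
Local Notation q := lift_coef.

Lemma deriv_lift_coef : q^`() = 4%:R * z - 2%:R * t1%:P.
Proof.
have shape (R : comNzRingType) (T C : R) (Z := 'X - T%:P) :
    (2%:R * Z ^+ 2 - 2%:R * T%:P * Z - C%:P)^`() = 4%:R * Z - 2%:R * T%:P.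
  by rewrite /Z !mulr_natl expr2 !derivE; ring.
by rewrite -(shape _ _ (t1 ^+ 2 + 3%:R * k * t2)) polyCD !polyCM polyC_natr opprD addrA.
Qed.

Lemma inv12_polyE : 12%:R * k%:P = 1 :> {poly S}.
Proof. by rewrite -polyC_natr -polyCM (inv12E two_neq0 three_neq0) polyC1. Qed.

Lemma coefwise_ramanujan_weierstrass :
  coefwise v P = 2%:R * 'X * P - 2%:R * q^`() * P + q * P^`().
Proof.
rewrite (coefwise_weierstrass (ramanujan_derivation two_neq0 three_neq0)).
rewrite ramanujan_t1 ?ramanujan_t2 ?ramanujan_t3 // deriv_weierstrass deriv_lift_coef.
have XE : 'X = z + t1%:P by rewrite subrK.
rewrite /weierstrass /lift_coef; set Z := (z) in XE *; rewrite XE.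
rewrite !(polyCB, polyCM, rmorphXn, rmorph_nat) /=.
have kE := inv12_polyE; move: Z (t1%:P) (t2%:P) (t3%:P) (k%:P) kE {XE} => Z T1 T2 T3 K kE.
apply/eqP; rewrite -subr_eq0; apply/eqP.
transitivity ((12%:R * K - 1) * (4%:R * Z ^+ 2 * T2)); last by rewrite kE subrr mul0r.
ring.
Qed.

Lemma deriv_weierstrass_lift : 4%:R * (q + 'X ^+ 2) = P^`().
Proof.
rewrite deriv_weierstrass.
have XE : 'X = z + t1%:P by rewrite subrK.
rewrite /lift_coef; set Z := (z) in XE *; rewrite XE.
have kE := inv12_polyE; move: Z (t1%:P) (t2%:P) (t3%:P) (k%:P) kE {XE} => Z T1 T2 T3 K kE.
apply/eqP; rewrite -subr_eq0; apply/eqP.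
transitivity ((1 - 12%:R * K) * T2); last by rewrite kE subrr mul0r.
ring.
Qed.

Variable s : nat.
Hypothesis s_gt1 : (1 < s)%N.
Hypothesis pF : s.*2.+1 \in [pchar F].

Lemma pchar_mpoly : s.*2.+1 \in [pchar S].
Proof. exact: (rmorph_pchar (@mpolyC 3 F) pF). Qed.

Lemma pchar_poly_mpoly : s.*2.+1 \in [pchar {poly S}].
Proof. exact: (rmorph_pchar (@polyC S) pchar_mpoly). Qed.

Local Notation e := (P ^+ s).
(** The first of two periods of a horizontal functional: P ^ s stands for 1 / y, as
    s = -1/2 in F, and the coefficient of x^(p-1) kills derivatives. This is the Hasse
    invariant of the family, the value at dx / y. *)
Definition hasse : S := e`_(s.*2).
(** The value of the same functional at x dx / y, see [first_integral_coefX]. *)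
Definition first_integral : S := e`_(s.*2.-1).

Lemma two_s : 2%:R * s%:R + 1 = 0 :> {poly S}.
Proof. by rewrite -natrM mulnC muln2 natr1 (pcharf0 pchar_poly_mpoly). Qed.

Lemma coef_deriv_pchar (h : {poly S}) : h^`()`_(s.*2) = 0.
Proof. by rewrite coef_deriv -mulr_natr (pcharf0 pchar_mpoly) mulr0. Qed.

Lemma first_integral_coefX : first_integral = ('X * e)`_(s.*2).
Proof. by rewrite /first_integral coefXM double_eq0 gtn_eqF // ltnW. Qed.

Lemma coefwise_power (D : S -> S) : derivation D ->
  coefwise D e = s%:R * P ^+ s.-1 * coefwise D P.
Proof. by move=> dD; rewrite (derivationX (coefwise_derivation dD)). Qed.

Lemma power_split : e = P * P ^+ s.-1.
Proof. by rewrite -exprS prednK // ltnW. Qed.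

Lemma deriv_power : e^`() = s%:R * P ^+ s.-1 * P^`().
Proof. by rewrite deriv_exp -mulr_natr; ring. Qed.

(** The Gauss-Manin connection along v sends dx / y to - x dx / y, up to the exact
    form d(q / y). *)
Lemma ramanujan_power : coefwise v e = (q * e)^`() - 'X * e.
Proof.
rewrite coefwise_power; last exact: ramanujan_derivation.
rewrite coefwise_ramanujan_weierstrass derivM deriv_power {1 2}power_split.
have E := two_s; move: 'X (q) P (s%:R) (q^`()) (P^`()) (P ^+ s.-1) E => X r Q c r' Q' N E.
apply/eqP; rewrite -subr_eq0; apply/eqP.
transitivity ((2%:R * c + 1) * (X * Q * N - r' * Q * N)); last by rewrite E mul0r.
ring.
Qed.

(** The Gauss-Manin connection along v sends x dx / y to an exact form. *)
Lemma ramanujan_X_power :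
  4%:R * ('X * coefwise v e) = (4%:R * ('X * (q * e)) - 2%:R * (P * e))^`().
Proof.
have PE : 2%:R * (P * e)^`() = P^`() * e.
  rewrite derivM deriv_power power_split; have E := two_s.
  move: P (s%:R) (P^`()) (P ^+ s.-1) E => Q c Q' N E.
  apply/eqP; rewrite -subr_eq0; apply/eqP.
  by transitivity ((2%:R * c + 1) * (Q' * Q * N)); [ring|rewrite E mul0r].
have natD n (h : {poly S}) : (n%:R * h)^`() = n%:R * h^`().
  by rewrite !mulr_natl derivMn.
rewrite ramanujan_power derivB !natD PE -deriv_weierstrass_lift [('X * _)^`()]derivM derivX.
by move: 'X (q) e ((q * e)^`()) => X r E E'; ring.
Qed.

Lemma ramanujan_hasse : v hasse = - first_integral.
Proof.
have vD := ramanujan_derivation two_neq0 three_neq0.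
by rewrite -(coef_coefwise vD) ramanujan_power coefB coef_deriv_pchar sub0r first_integral_coefX.
Qed.

Lemma ramanujan_first_integral : v first_integral = 0.
Proof.
have vD := ramanujan_derivation two_neq0 three_neq0.
have four_neq0 : 4%:R != 0 :> S.
  by rewrite -mpolyC_nat mpolyC_eq0 (natrM _ 2 2) mulf_neq0.
apply: (mulfI four_neq0); rewrite mulr0 first_integral_coefX -(coef_coefwise vD).
rewrite (derivationM (coefwise_derivation vD)) (coefwiseX vD) mul0r add0r.
have := coef_deriv_pchar (4%:R * ('X * (q * e)) - 2%:R * (P * e)).
by rewrite -ramanujan_X_power !mulr_natl coefMn.
Qed.

(** The parameter t1 enters through x - t1 only. *)
Lemma mderiv1_power : coefwise (mderiv i0) e = - e^`().
Proof.
have dM := mderiv_derivation F i0.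
rewrite (coefwise_power dM) deriv_power (coefwise_weierstrass dM) deriv_weierstrass.
rewrite !mderivXU eqxx !inord3_neq /= polyC0 polyC1; ring.
Qed.

Lemma mderiv1_hasse : mderiv i0 hasse = 0.
Proof.
have dM := mderiv_derivation F i0.
by rewrite -(coef_coefwise dM) mderiv1_power coefN coef_deriv_pchar oppr0.
Qed.

Lemma mderiv1_first_integral : mderiv i0 first_integral = hasse.
Proof.
have dM := mderiv_derivation F i0.
rewrite -(coef_coefwise dM) mderiv1_power coefN coef_deriv prednK ?double_gt0; last exact: ltnW.
apply/esym/eqP.
by rewrite -addr_eq0 -mulrS -mulr_natr (pcharf0 pchar_mpoly) mulr0.
Qed.

End Weierstrass.

(** * Weights *)

Section Weights.
Variable F : fieldType.
Local Notation S := {mpoly F[3]}.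
Local Notation t1 := ('X_i0 : S).
Local Notation t2 := ('X_i1 : S).
Local Notation t3 := ('X_i2 : S).
Local Notation v := (@ramanujan F).
Local Notation k := (inv12 F).

Lemma wtE m : wt m = (2 * m i0 + 4 * m i1 + 6 * m i2)%N.
Proof. by rewrite /wt big_ord3 !inordK // [(m i0 * _)%N]mulnC [(m i1 * _)%N]mulnC [(m i2 * _)%N]mulnC. Qed.

Lemma wtU (i : 'I_3) : wt U_(i)%MM = (2 * i.+1)%N.
Proof.
by move: i; apply: ord3_ind; rewrite wtE !mnm1E !eqxx !inord3_neq inordK.
Qed.

Lemma homogXU (i : 'I_3) : ('X_i : S) \is (2 * i.+1).-homog for wt.
Proof. by rewrite dhomogX /= wtU. Qed.

Lemma homog_t1 : t1 \is 2.-homog for wt. Proof. by have := homogXU i0; rewrite inordK. Qed.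
Lemma homog_t2 : t2 \is 4.-homog for wt. Proof. by have := homogXU i1; rewrite inordK. Qed.
Lemma homog_t3 : t3 \is 6.-homog for wt. Proof. by have := homogXU i2; rewrite inordK. Qed.

Lemma homogC c : (c%:MP : S) \is 0.-homog for wt.
Proof. by rewrite -[c%:MP]mulr1 mul_mpolyC dhomogZ ?dhomog1. Qed.

(** Stated with a relation between the weights, since the weight of the derivative
    is a truncated difference. *)
Lemma homog_mderiv (i : 'I_3) c g n d m : (n + m = d + 2 * i.+1)%N ->
  c \is n.-homog for wt -> g \is m.-homog for wt ->
  (c * mderiv i g : S) \is d.-homog for wt.
Proof.
move=> E /dhomogP hc /dhomogP hg; apply/dhomogP => u /msuppM_le /allpairsP[[u1 u2] /= [cu1 gu2 ->]].
have : (u2 + U_(i))%MM \in msupp g.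
  move: gu2; rewrite !mcoeff_msupp mcoeff_deriv; apply: contraNneq => ->; by rewrite mul0rn.
by move/hg; rewrite /= !wtD wtU (hc _ cu1) /=; lia.
Qed.

Lemma homog_ramanujan g d : g \is d.-homog for wt -> v g \is d.+2.-homog for wt.
Proof.
move=> hg; rewrite /ramanujan.
have h0 := homog_t1; have h1 := homog_t2; have h2 := homog_t3.
have hn n c u : u \is c.-homog for wt -> (n%:R * u : S) \is c.-homog for wt.
  by move=> hu; rewrite mulr_natl rpredMn.
have hM n c u w e : (n = c + e)%N -> u \is c.-homog for wt -> w \is e.-homog for wt ->
  (u * w : S) \is n.-homog for wt.
  by move=> ->; apply: dhomogM.
apply: rpredD; first apply: rpredD.
- apply: (homog_mderiv (n := 4) (m := d)) => //; first by rewrite inordK //; lia.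
  by apply: rpredB; [apply: (hM _ 2 _ _ 2)|apply: dhomogZ].
- apply: (homog_mderiv (n := 6) (m := d)) => //; first by rewrite inordK //; lia.
  by rewrite -mulrA; apply: rpredB; apply: hn => //; apply: (hM _ 2 _ _ 4).
- apply: (homog_mderiv (n := 8) (m := d)) => //; first by rewrite inordK //; lia.
  by rewrite -mulrA; apply: rpredB; [apply: hn; apply: (hM _ 2 _ _ 6)|apply: dhomogZ; apply: (hM _ 4 _ _ 4)].
Qed.

Lemma homog_iter_ramanujan n g d : g \is d.-homog for wt ->
  iter n v g \is (d + n.*2).-homog for wt.
Proof.
move=> hg; elim: n => [|n IHn]; first by rewrite addn0.
by rewrite iterS doubleS !addnS; apply: homog_ramanujan.
Qed.

Lemma euler_homog (g : S) d : g \is d.-homog for wt -> euler g = d%:R * g.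
Proof.
move=> /dhomogP hg; have eD := euler_derivation F.
rewrite [in LHS](mpolyE g) [in RHS](mpolyE g) mulr_sumr.
rewrite (big_morph _ (derivationD eD) (derivation0 eD)) /=.
apply: eq_big_seq => m /hg /= wm; rewrite -!mul_mpolyC.
rewrite (derivationM eD) eulerC mul0r add0r [RHS]mulrCA; congr (_ * _).
have X_mderiv i : 'X_i * mderiv i 'X_[m] = (m i)%:R * 'X_[m] :> S.
  rewrite mderivX -mul_mpolyC mpolyC_nat mulrCA -mpolyXD.
  have [m0|m_gt0] := posnP (m i); first by rewrite m0 !mul0r.
  congr (_ * 'X_[_]); apply/mnmP => l; rewrite mnmDE mnmBE mnm1E.
  by case: eqP => [<-|_]; rewrite ?subn0 // add1n subn1 prednK.
rewrite /euler -!mulrA !X_mderiv -wm wtE; ring.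
Qed.

(** Homogeneity for the weights of S extended by giving X the weight 2. *)
Definition bihomog d (Q : {poly S}) :=
  forall j m, m \in msupp Q`_j -> (wt m + j.*2 = d)%N.

Lemma bihomogM d d' (Q Q' : {poly S}) : bihomog d Q -> bihomog d' Q' -> bihomog (d + d') (Q * Q').
Proof.
move=> hQ hQ' j m; rewrite coefM => /msupp_sum_le /flattenP[_ /mapP[i _ ->]].
move=> /msuppM_le /allpairsP[[m1 m2] /= [/hQ <- /hQ' <- ->]].
by rewrite wtD; have := ltn_ord i; lia.
Qed.

Lemma bihomogX d Q n : bihomog d Q -> bihomog (n * d) (Q ^+ n).
Proof.
move=> hQ; elim: n => [|n IHn]; last by rewrite exprS mulSn; apply: bihomogM.
move=> j m; rewrite coef1 mcoeff_msupp; case: j => [|j]; last by rewrite mcoeff0 eqxx.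
by rewrite mcoeff1; case: (m =P 0%MM) => [->|]; rewrite ?eqxx //= wt0.
Qed.

Lemma bihomogB d Q Q' : bihomog d Q -> bihomog d Q' -> bihomog d (Q - Q').
Proof.
move=> hQ hQ' j m; rewrite coefB => /msuppB_le; rewrite mem_cat => /orP[].
  exact: hQ.
exact: hQ'.
Qed.

Lemma bihomogC d (c : S) : c \is d.-homog for wt -> bihomog d c%:P.
Proof.
move=> /dhomogP hc [|j] m; rewrite coefC /= ?msupp0 //.
by move=> /hc <-; rewrite addn0.
Qed.

Lemma bihomog_weierstrass : bihomog 6 (weierstrass F).
Proof.
have h0 := homog_t1; have h1 := homog_t2; have h2 := homog_t3.
have hz : bihomog 2 ('X - t1%:P).
  apply: bihomogB; last exact: bihomogC.
  move=> j m; rewrite coefX mcoeff_msupp; case: (j =P 1%N) => [->|_]; last by rewrite mcoeff0 eqxx.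
  by rewrite mulr1n mcoeff1; case: (m =P 0%MM) => [->|]; rewrite ?eqxx //= wt0.
apply: bihomogB; last exact: bihomogC.
apply: bihomogB; last by apply: (@bihomogM 4 2) => //; apply: bihomogC.
apply: (@bihomogM 0 6); last exact: (@bihomogX 2 _ 3).
by rewrite -polyC_natr; apply: bihomogC; rewrite -mpolyC_nat homogC.
Qed.

Lemma homog_coef_weierstrass s j d : (d + j.*2 = 6 * s)%N ->
  (weierstrass F ^+ s)`_j \is d.-homog for wt.
Proof.
move=> E; apply/dhomogP => m /(bihomogX (n := s) bihomog_weierstrass) /=.
lia.
Qed.

(** A polynomial killed by d/dt1 involves t1 through t1^p only, which has weight 2 p.
    In the remaining range of weights, the cofactor of t1^p would have weight 1, 2 or 3,
    and no monomial in t2 and t3 has such a weight. *)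
Lemma t1_free_of_mderiv p (g : S) d : p \in [pchar F] -> (d < 2 * p + 4)%N -> d <> (2 * p)%N ->
  g \is d.-homog for wt -> mderiv i0 g = 0 -> t1_free g.
Proof.
move=> pF dp d2p /dhomogP hg dg m gm; have := hg m gm; rewrite /= wtE => wm.
case E : (m i0) => [//|n]; exfalso.
have : (mderiv i0 g)@_(m - U_(i0)) = 0 by rewrite dg mcoeff0.
have -> : (mderiv i0 g)@_(m - U_(i0)) = g@_m * n.+1%:R.
  rewrite mcoeff_deriv submK ?lep1mP ?E // mnmBE mnm1E eqxx subn1 /= E.
  by rewrite mulr_natr.
move=> /eqP; rewrite mulf_eq0 mcoeff_eq0 gm /=.
have p_gt1 := prime_gt1 (pcharf_prime pF).
by rewrite -(dvdn_pcharf pF) => /dvdnP[[|[|c]] Ec]; nia.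
Qed.

End Weights.

(** * The nodal cubic *)

Section Cusp.
Variable F : fieldType.
Local Notation S := {mpoly F[3]}.
Local Notation t1 := ('X_i0 : S).
Local Notation t2 := ('X_i1 : S).
Local Notation t3 := ('X_i2 : S).
Local Notation v := (@ramanujan F).
Local Notation k := (inv12 F).
Hypothesis two_neq0 : 2%:R != 0 :> F.
Hypothesis three_neq0 : 3%:R != 0 :> F.

Local Notation kappa := (1 / 12%:R : F).
(** The point a. The cubic above it is nodal, see [cusp_weierstrass]: a lies over the cusp
    of the modular curve, where the Fourier parameter vanishes. *)
Definition cusp : 'cV[F]_3 := vec3 (- (1 / 12%:R)) (1 / 12%:R) (- (1 / 216%:R)).
(** The direction b, given by the coefficients of order 1 in the Fourier expansions of
    the Eisenstein series. *)
Definition cusp_tangent : 'cV[F]_3 := vec3 2%:R 20%:R (7%:R / 3%:R).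

Definition at_cusp : S -> F := eval_at cusp.
HB.instance Definition _ := GRing.RMorphism.copy at_cusp (meval (fun i => cusp i 0)).

Lemma at_cuspD g h : at_cusp (g + h) = at_cusp g + at_cusp h. Proof. exact: rmorphD. Qed.
Lemma at_cuspB g h : at_cusp (g - h) = at_cusp g - at_cusp h. Proof. exact: rmorphB. Qed.
Lemma at_cuspN g : at_cusp (- g) = - at_cusp g. Proof. exact: rmorphN. Qed.
Lemma at_cuspM g h : at_cusp (g * h) = at_cusp g * at_cusp h. Proof. exact: rmorphM. Qed.
Lemma at_cuspX g n : at_cusp (g ^+ n) = at_cusp g ^+ n. Proof. exact: rmorphXn. Qed.
Lemma at_cusp_nat n : at_cusp n%:R = n%:R. Proof. exact: rmorph_nat. Qed.

Lemma vec3E (x y w : F) : ((vec3 x y w i0 0 = x) * (vec3 x y w i1 0 = y) * (vec3 x y w i2 0 = w))%type.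
Proof. by rewrite !mxE !inordK. Qed.

Lemma kappaE : 12%:R * kappa = 1.
Proof. by rewrite mulrCA divff ?mulr1 // twelve_neq0. Qed.

Lemma at_cusp_t1 : at_cusp t1 = - kappa.
Proof. by rewrite /at_cusp /eval_at mevalXU vec3E. Qed.
Lemma at_cusp_t2 : at_cusp t2 = kappa.
Proof. by rewrite /at_cusp /eval_at mevalXU vec3E. Qed.
Lemma at_cusp_t3 : at_cusp t3 = - (8%:R * kappa ^+ 3).
Proof.
rewrite /at_cusp /eval_at mevalXU vec3E; congr (- _).
have n12 := twelve_neq0 two_neq0 three_neq0.
have n216 : 216%:R != 0 :> F by rewrite (natrM _ 12 18) (natrM _ 2 9) (natrM _ 3 3) !mulf_neq0.
by field; rewrite n12 n216.
Qed.
Lemma at_cuspC c : at_cusp c%:MP = c. Proof. exact: mevalC. Qed.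

Lemma cusp_weierstrass : map_poly at_cusp (weierstrass F) = 'X ^+ 2 * (1 + 4%:R * 'X).
Proof.
rewrite /weierstrass !(rmorphB, rmorphM, rmorphXn, rmorph_nat) /= map_polyX !map_polyC /=.
rewrite at_cusp_t1 at_cusp_t2 at_cusp_t3; have := kappaE; move: (kappa) => c cE.
have {cE} : 12%:R * c%:P = 1 by rewrite -polyC_natr -polyCM cE.
rewrite !polyCN polyCM rmorphXn polyC_natr /=.
move: (c%:P) => K KE; apply/eqP; rewrite -subr_eq0; apply/eqP.
transitivity ((12%:R * K - 1) * ('X ^+ 2 + K * 'X + K ^+ 2)); last by rewrite KE subrr mul0r.
ring.
Qed.

(** The binomial coefficients C(n, 1) and C(n, 2), written without division. *)
Lemma coef_power_affine n (L := (1 + 4%:R * 'X) ^+ n : {poly F}) :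
  [/\ L`_0 = 1, L`_1 = 4%:R * n%:R & 2%:R * L`_2 + 16%:R * n%:R = 16%:R * n%:R ^+ 2].
Proof.
rewrite /L {L}; elim: n => [|n [IH0 IH1 IH2]].
  by rewrite expr0 !coef1 /=; split=> //; ring.
set L := (_ ^+ n) in IH0 IH1 IH2.
have E : (1 + 4%:R * 'X) ^+ n.+1 = L + (L * 'X) *+ 4 by rewrite exprS -/L; ring.
rewrite E !(coefMn, coefMX, coefD) /= IH0 IH1 -natr1; split; [ring|ring|].
transitivity (2%:R * L`_2 + 16%:R * n%:R + 16%:R * (2%:R * n%:R + 1)); first by ring.
by rewrite IH2; ring.
Qed.

Variable s : nat.
Hypothesis s_gt1 : (1 < s)%N.
Hypothesis pF : s.*2.+1 \in [pchar F].

Local Notation hasse := (hasse F s).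
Local Notation first_integral := (first_integral F s).

Lemma two_sF : 2%:R * s%:R + 1 = 0 :> F.
Proof. by rewrite -natrM mulnC muln2 natr1 (pcharf0 pF). Qed.

Lemma at_cusp_coef (Q : {poly S}) i : at_cusp Q`_i = (map_poly at_cusp Q)`_i.
Proof. by rewrite coef_map. Qed.

Lemma at_cusp_power : map_poly at_cusp (weierstrass F ^+ s) = 'X^(s.*2) * (1 + 4%:R * 'X) ^+ s.
Proof. by rewrite rmorphXn /= cusp_weierstrass exprMn -exprM mul2n. Qed.

Lemma at_cusp_hasse : at_cusp hasse = 1.
Proof.
rewrite at_cusp_coef at_cusp_power coefXnM ltnn subnn.
by case: (coef_power_affine s).
Qed.

Lemma at_cusp_first_integral : at_cusp first_integral = 0.
Proof. by rewrite at_cusp_coef at_cusp_power coefXnM ltn_predL double_gt0 ltnW. Qed.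

Lemma at_cusp_mderiv i j (G := map_poly at_cusp (coefwise (mderiv i) (weierstrass F))) :
  at_cusp (mderiv i (weierstrass F ^+ s)`_(s.-1.*2 + j)) =
  s%:R * ((1 + 4%:R * 'X) ^+ s.-1 * G)`_j.
Proof.
have dM := mderiv_derivation F i.
rewrite -(coef_coefwise dM) (coefwise_power _ dM) at_cusp_coef.
rewrite !(rmorphM, rmorphXn, rmorph_nat) /= cusp_weierstrass exprMn -exprM mul2n -/G.
by rewrite -!mulrA [s%:R * _]mulr_natl coefMn coefXnM ltnNge leq_addr /= addKn [RHS]mulr_natl.
Qed.

(** Here (1 + 4 x)^(s - 1) stands for (1 + 4 x)^(-3/2) = 1 - 6 x + 30 x^2 - ... *)
Lemma coefM_affine_power (G : {poly F}) :
  ((1 + 4%:R * 'X) ^+ s.-1 * G)`_1 = G`_1 - 6%:R * G`_0 /\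
  ((1 + 4%:R * 'X) ^+ s.-1 * G)`_2 = G`_2 - 6%:R * G`_1 + 30%:R * G`_0.
Proof.
have [L0 L1 L2] := coef_power_affine s.-1.
have E : 2%:R * s.-1%:R = - 3%:R :> F.
  have := two_sF; rewrite -[in X in X -> _](prednK (ltnW s_gt1)) -natr1 => E.
  by apply/eqP; rewrite -subr_eq0 -E; apply/eqP; ring.
have L1' : ((1 + 4%:R * 'X) ^+ s.-1 : {poly F})`_1 = - 6%:R.
  by rewrite L1 (_ : 4%:R * _ = 2%:R * (2%:R * s.-1%:R)); [rewrite E; ring|ring].
have L2' : ((1 + 4%:R * 'X) ^+ s.-1 : {poly F})`_2 = 30%:R.
  apply: (mulfI two_neq0); apply: (addIr (16%:R * s.-1%:R)); rewrite L2.
  transitivity (4%:R * (2%:R * s.-1%:R) ^+ 2 : F); first by ring.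
  transitivity (60%:R + 8%:R * (2%:R * s.-1%:R) : F); last by ring.
  by rewrite E; ring.
rewrite !coefM !big_ord_recl !big_ord0 /= /bump /= !addn0 !add1n !subn0 !subSS ?subn0 L0 L1' L2'.
by split; ring.
Qed.

Lemma cusp_mderiv_weierstrass i :
  map_poly at_cusp (coefwise (mderiv i) (weierstrass F)) =
  if i == i0 then - (12%:R * 'X ^+ 2) - 2%:R * 'X
  else if i == i1 then - 'X - kappa%:P else -1.
Proof.
have shape (f : {rmorphism {poly S} -> {poly F}}) (T Z x y w : {poly S}) :
    f ((T - 12%:R * Z ^+ 2) * x - Z * y - w) =
    (f T - 12%:R * f Z ^+ 2) * f x - f Z * f y - f w.
  by rewrite !(rmorphB, rmorphM, rmorphXn) rmorph_nat.
have XE : map_poly at_cusp ('X - t1%:P) = 'X + kappa%:P.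
  by rewrite rmorphB /= map_polyX map_polyC /= at_cusp_t1 polyCN opprK.
rewrite (coefwise_weierstrass (mderiv_derivation F i)) shape /= XE !map_polyC /= at_cusp_t2 !mderivXU.
have : 12%:R * kappa%:P = 1 by rewrite -polyC_natr -polyCM kappaE.
move: (kappa%:P) => K KE.
move: i; apply: ord3_ind; rewrite !eqxx !inord3_neq /= rmorph0 rmorph1 polyC0 polyC1; [|ring|ring].
apply/eqP; rewrite -subr_eq0; apply/eqP.
transitivity ((1 - 12%:R * K) * (2%:R * 'X + K)); last by rewrite KE subrr mul0r.
ring.
Qed.

Lemma grad_hasse :
  [/\ at_cusp (mderiv i0 hasse) = 0, at_cusp (mderiv i1 hasse) = s%:R * (7%:R / 2%:R)
    & at_cusp (mderiv i2 hasse) = - (s%:R * 30%:R)].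
Proof.
rewrite /hasse (_ : s.*2 = (s.-1.*2 + 2)%N); last by case: s s_gt1 => // n _; rewrite doubleS addn2.
rewrite !at_cusp_mderiv // !(coefM_affine_power _).2 !cusp_mderiv_weierstrass !eqxx !inord3_neq.
rewrite !mulr_natl !(coefB, coefN, coefMn, coefXn, coefX, coefC, coef1) /=.
have n12 := twelve_neq0 two_neq0 three_neq0.
split; [ring|by field; rewrite n12 two_neq0|ring].
Qed.

Lemma grad_first_integral :
  [/\ at_cusp (mderiv i0 first_integral) = - (s%:R * 2%:R),
      at_cusp (mderiv i1 first_integral) = - (s%:R / 2%:R)
    & at_cusp (mderiv i2 first_integral) = s%:R * 6%:R].
Proof.
rewrite /first_integral (_ : s.*2.-1 = (s.-1.*2 + 1)%N); last by case: s s_gt1 => // n _; rewrite doubleS addn1.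
rewrite !at_cusp_mderiv // !(coefM_affine_power _).1 !cusp_mderiv_weierstrass !eqxx !inord3_neq.
rewrite !mulr_natl !(coefB, coefN, coefMn, coefXn, coefX, coefC, coef1) /=.
have n12 := twelve_neq0 two_neq0 three_neq0.
split; [ring|by field; rewrite n12 two_neq0|ring].
Qed.

End Cusp.

Section Tangent.
Variable F : fieldType.
Local Notation S := {mpoly F[3]}.
Local Notation t1 := ('X_i0 : S).
Local Notation t2 := ('X_i1 : S).
Local Notation t3 := ('X_i2 : S).
Local Notation v := (@ramanujan F).
Local Notation k := (inv12 F).
Hypothesis two_neq0 : 2%:R != 0 :> F.
Hypothesis three_neq0 : 3%:R != 0 :> F.
Local Notation kappa := (1 / 12%:R : F).
Local Notation at_cusp := (@at_cusp F).
Local Notation cusp := (cusp F).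
Local Notation cusp_tangent := (cusp_tangent F).

Definition along_tangent (g : S) : F := \sum_i eval_at cusp (mderiv i g) * cusp_tangent i 0.

Lemma along_tangentE g : along_tangent g =
  at_cusp (mderiv i0 g) * 2%:R + at_cusp (mderiv i1 g) * 20%:R
  + at_cusp (mderiv i2 g) * (7%:R / 3%:R).
Proof. by rewrite /along_tangent big_ord3 /= !vec3E. Qed.

Lemma along_tangentD g h : along_tangent (g + h) = along_tangent g + along_tangent h.
Proof.
rewrite /along_tangent -big_split; apply: eq_bigr => i _ /=.
by rewrite mderivD /eval_at mevalD mulrDl.
Qed.
Lemma along_tangentN g : along_tangent (- g) = - along_tangent g.
Proof.
rewrite /along_tangent -sumrN; apply: eq_bigr => i _.
by rewrite mderivN /eval_at mevalN mulNr.
Qed.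
Lemma along_tangentB g h : along_tangent (g - h) = along_tangent g - along_tangent h.
Proof. by rewrite along_tangentD along_tangentN. Qed.
Lemma along_tangentC c : along_tangent c%:MP = 0.
Proof. by rewrite along_tangentE !mderivC rmorph0 !mul0r !addr0. Qed.
Lemma along_tangentM g h :
  along_tangent (g * h) = along_tangent g * at_cusp h + at_cusp g * along_tangent h.
Proof.
rewrite /along_tangent mulr_suml mulr_sumr -big_split; apply: eq_bigr => i _ /=.
by rewrite mderivM /eval_at mevalD !mevalM mulrDl mulrAC mulrA.
Qed.

Lemma along_tangentXU : ((along_tangent t1 = 2%:R) * (along_tangent t2 = 20%:R)
  * (along_tangent t3 = 7%:R / 3%:R))%type.
Proof.
rewrite !along_tangentE !mderivXU !eqxx !inord3_neq /= rmorph0 rmorph1.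
by rewrite !mul0r !mul1r ?addr0 ?add0r.
Qed.

Lemma at_cusp_inv12 : at_cusp k = kappa. Proof. exact: at_cuspC. Qed.

Lemma ramanujan_coordinates_cusp :
  [/\ at_cusp (v t1) = 0, at_cusp (v t2) = 0 & at_cusp (v t3) = 0].
Proof.
rewrite ramanujan_t1 // ramanujan_t2 // ramanujan_t3 //.
rewrite !(at_cuspB, at_cuspX, at_cuspM, at_cusp_nat) at_cusp_inv12.
rewrite at_cusp_t1 at_cusp_t2 at_cusp_t3 //.
have := kappaE two_neq0 three_neq0; move: (kappa) => c cE.
split; first by ring.
  transitivity ((12%:R * c - 1) * (4%:R * c ^+ 2)); first by ring.
  by rewrite cE subrr mul0r.
transitivity ((12%:R * c - 1) * (4%:R * c ^+ 3)); first by ring.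
by rewrite cE subrr mul0r.
Qed.

Lemma ramanujan_chain g :
  v g = v t1 * mderiv i0 g + v t2 * mderiv i1 g + v t3 * mderiv i2 g.
Proof. by rewrite [LHS]ramanujanE // ramanujan_t1 // ramanujan_t2 // ramanujan_t3. Qed.

Lemma ramanujan_cusp g : at_cusp (v g) = 0.
Proof.
have [v1 v2 v3] := ramanujan_coordinates_cusp.
by rewrite ramanujan_chain !at_cuspD !at_cuspM v1 v2 v3 !mul0r !addr0.
Qed.

(** As v vanishes at a, it has a linear part there; b is one of its eigenvectors. *)
Lemma along_tangent_ramanujan g : along_tangent (v g) = - along_tangent g.
Proof.
have [v1 v2 v3] := ramanujan_coordinates_cusp.
rewrite ramanujan_chain !along_tangentD !along_tangentM v1 v2 v3 !mul0r !addr0.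
rewrite ramanujan_t1 // ramanujan_t2 // ramanujan_t3 // !(along_tangentB, expr2, along_tangentM).
rewrite -!mpolyC_nat !along_tangentC !along_tangentXU !(at_cuspM, at_cuspC).
rewrite ?at_cusp_inv12 at_cusp_t1 at_cusp_t2 at_cusp_t3 // along_tangentE.
have n12 := twelve_neq0 two_neq0 three_neq0.
field; rewrite ?n12 ?three_neq0 //.
Qed.

Lemma along_tangent_iter n g : along_tangent (iter n v g) = (- 1) ^+ n * along_tangent g.
Proof.
elim: n => [|n IHn]; first by rewrite expr0 mul1r.
by rewrite iterS along_tangent_ramanujan IHn exprS; ring.
Qed.

Variable s : nat.
Hypothesis s_gt1 : (1 < s)%N.
Hypothesis pF : s.*2.+1 \in [pchar F].
Local Notation hasse := (hasse F s).
Local Notation first_integral := (first_integral F s).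

Lemma along_tangent_hasse : along_tangent hasse = 0.
Proof.
have [g0 g1 g2] := grad_hasse two_neq0 three_neq0 s_gt1 pF.
by rewrite along_tangentE g0 g1 g2; field; rewrite two_neq0 three_neq0.
Qed.

Lemma along_tangent_first_integral : along_tangent first_integral = 0.
Proof.
have [g0 g1 g2] := grad_first_integral two_neq0 three_neq0 s_gt1 pF.
by rewrite along_tangentE g0 g1 g2; field; rewrite two_neq0 three_neq0.
Qed.

Lemma half_neq0 : s%:R != 0 :> F.
Proof.
apply/eqP => s0; have := two_sF pF; rewrite s0 mulr0 add0r => /eqP; rewrite oner_eq0.
by [].
Qed.

(** With u the factor s, the gradients are u (0, 7/2, -30) and u (-2, -1/2, 6). They are
    independent because only the second has a nonzero first entry, while 7 and 30 have no
    common prime factor. *)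
Lemma smooth_cusp : smooth_curve_at [tuple hasse - 1; first_integral] cusp.
Proof.
have [A0 A1 A2] := grad_hasse two_neq0 three_neq0 s_gt1 pF.
have [f0 f1 f2] := grad_first_integral two_neq0 three_neq0 s_gt1 pF.
apply/eqP; change (row_free (jacobian [tuple hasse - 1; first_integral] cusp)).
apply: inj_row_free => u uJ.
have row j : u 0 ord0 * at_cusp (mderiv j hasse)
    + u 0 (lift ord0 ord0) * at_cusp (mderiv j first_integral) = 0.
  have := congr1 (fun M : 'rV_3 => M 0 j) uJ.
  rewrite !mxE !big_ord_recl big_ord0 !mxE addr0 !(tnth_nth 0) /=.
  by rewrite mderivB -mpolyC1 mderivC subr0.
suff [u0 u1] : u 0 ord0 = 0 /\ u 0 (lift ord0 ord0) = 0.
  apply/rowP => j; rewrite mxE; case: (unliftP ord0 j) => [j' ->|->] //.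
  by rewrite (ord1 j').
move: (u 0 ord0) (u 0 (lift ord0 ord0)) row => x y row.
have y0 : y = 0.
  have /eqP := row i0; rewrite A0 f0 mulr0 add0r mulrN oppr_eq0 !mulf_eq0.
  by rewrite (negPf half_neq0) (negPf two_neq0) !orbF => /eqP.
have x0 : x = 0.
  have := row i1; have := row i2; rewrite y0 !mul0r !addr0 A1 A2 => E2 E1.
  apply: (mulfI (mulf_neq0 half_neq0 two_neq0)); rewrite mulr0.
  transitivity (- (x * - (s%:R * 30%:R)) - 8%:R * (x * (s%:R * (7%:R / 2%:R)))).
    by field; rewrite two_neq0.
  by rewrite E1 E2 oppr0 mulr0 subr0.
by [].
Qed.

End Tangent.

(** * A Fuchsian system modulo p *)

Section Fuchs.
Variable F : fieldType.
Hypothesis two_neq0 : 2%:R != 0 :> F.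
Hypothesis three_neq0 : 3%:R != 0 :> F.
Variable kappa : F.
Hypothesis kappaE : 12%:R * kappa = 1.
Local Notation K := (kappa%:P).

(** A Fuchsian system on the line, singular at X = 1 and X = -1, which is
    [ramanujan_defectXU] after dehomogenization. A solution of order n at X = -1 has its
    leading coefficients in the kernel of a matrix of determinant n^2 (n - 1) up to a unit,
    so a solution of order at least 2 has order at least p; then its degree forces it to
    be zero. *)
Lemma fuchs_polynomial_zero p (Y1 Y2 Y3 : {poly F}) : p \in [pchar F] ->
  ('X ^+ 2 - 1) * Y1^`() - 4%:R * K * (1 + 'X) * Y1 = 2%:R * (- (2%:R * K * Y1) - K * Y2) ->
  ('X ^+ 2 - 1) * Y2^`() - 8%:R * K * (1 + 'X) * Y2 = 2%:R * (4%:R * K * Y1 - 4%:R * K * Y2 - 6%:R * Y3) ->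
  ('X ^+ 2 - 1) * Y3^`() - 12%:R * K * (1 + 'X) * Y3 =
    2%:R * (48%:R * K ^+ 3 * 'X * Y1 - 6%:R * K * Y3 - 8%:R * K ^+ 2 * Y2) ->
  (forall Y, Y \in [:: Y1; Y2; Y3] -> (size Y <= p)%N /\ (Y.[-1] = 0 /\ Y^`().[-1] = 0)) ->
  [/\ Y1 = 0, Y2 = 0 & Y3 = 0].
Proof.
move=> pF E1 E2 E3 init.
set xi : {poly F} := 'X - (-1)%:P.
have xi0 : xi != 0 by rewrite polyXsubC_eq0.
have xiE : 'X = xi - 1 by rewrite /xi polyCN polyC1; ring.
have xi_eval : xi.[-1] = 0 by rewrite !hornerE subrr.
have divY n : (1 < n <= p)%N ->
  exists Z1 Z2 Z3, [/\ Y1 = Z1 * xi ^+ n, Y2 = Z2 * xi ^+ n & Y3 = Z3 * xi ^+ n].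
  elim: n => [|[|n] IHn] //; have [n0 _|n_gt0 /andP[_ np]] := posnP n.
    have fact Y : Y \in [:: Y1; Y2; Y3] -> exists Z, Y = Z * xi ^+ 2.
      move=> /init[_ [/eqP/factor_theorem[Z1 ZE] dY]].
      have /eqP/factor_theorem[Z2 Z1E] : Z1.[-1] = 0.
        move: dY; rewrite ZE derivM derivXsubC mulr1 hornerD hornerM.
        by rewrite -/xi xi_eval mulr0 add0r.
      by exists Z2; rewrite ZE Z1E -/xi expr2 mulrA.
    rewrite n0; have [|Z1 ?] := fact Y1; first by rewrite !inE eqxx.
    have [|Z2 ?] := fact Y2; first by rewrite !inE eqxx orbT.
    have [|Z3 ?] := fact Y3; first by rewrite !inE eqxx !orbT.
    by exists Z1, Z2, Z3.
  have [|Z1 [Z2 [Z3 [Z1E Z2E Z3E]]]] := IHn; first by rewrite ltnS n_gt0 ltnW.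
  set N := n.+1 in np Z1E Z2E Z3E *.
  have xiN0 : xi ^+ N != 0 by rewrite expf_neq0.
  have red (Z W : {poly F}) (c : F) :
      ('X ^+ 2 - 1) * (Z * xi ^+ N)^`() - c%:P * (1 + 'X) * (Z * xi ^+ N) = W * xi ^+ N ->
      W.[-1] = - (2%:R * N%:R * Z.[-1]).
    move=> E; suff -> : W = ('X - 1) * (N%:R * Z + xi * Z^`()) - c%:P * xi * Z.
      rewrite -(polyC_natr _ N) /xi !(hornerD, hornerN, hornerM, hornerX, hornerC).
      by ring.
    apply: (mulIf xiN0); rewrite -E derivM deriv_exp derivXsubC mul1r -mulr_natr /=.
    rewrite xiE /N /= (exprS xi n); move: (xi) (xi ^+ n) (n.+1%:R : {poly F}) (Z^`()) => x y m Z'; ring.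
  have kc n' (Q : {poly F}) : n'%:R * K * (1 + 'X) * Q = (n'%:R * kappa)%:P * (1 + 'X) * Q.
    by rewrite polyCM polyC_natr.
  set W1 := 2%:R * (- (2%:R * K * Z1) - K * Z2).
  have F1 : W1.[-1] = - (2%:R * N%:R * Z1.[-1]).
    apply: (red _ _ (4%:R * kappa)); rewrite -kc -Z1E E1 Z1E Z2E /W1; ring.
  set W2 := 2%:R * (4%:R * K * Z1 - 4%:R * K * Z2 - 6%:R * Z3).
  have F2 : W2.[-1] = - (2%:R * N%:R * Z2.[-1]).
    apply: (red _ _ (8%:R * kappa)); rewrite -kc -Z2E E2 Z1E Z2E Z3E /W2; ring.
  set W3 := 2%:R * (48%:R * K ^+ 3 * 'X * Z1 - 6%:R * K * Z3 - 8%:R * K ^+ 2 * Z2).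
  have F3 : W3.[-1] = - (2%:R * N%:R * Z3.[-1]).
    apply: (red _ _ (12%:R * kappa)); rewrite -kc -Z3E E3 Z1E Z2E Z3E /W3; ring.
  move: F1 F2 F3; rewrite /W1 /W2 /W3 -!polyC_natr -!rmorphXn.
  rewrite !(hornerD, hornerN, hornerM, hornerX, hornerC).
  have nF : n%:R != 0 :> F.
    rewrite -(dvdn_pcharf pF); apply/negP => /dvdn_leq; rewrite /N in np; lia.
  have NF : N%:R != 0 :> F by rewrite -(dvdn_pcharf pF); apply/negP => /dvdn_leq; lia.
  have NE : N%:R = n%:R + 1 :> F by rewrite /N -natr1.
  have n12 : 12%:R != 0 :> F by apply: twelve_neq0.
  move=> F1 F2 F3.
  have [z1 z2 z3] : [/\ Z1.[-1] = 0, Z2.[-1] = 0 & Z3.[-1] = 0].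
    move: (Z1.[-1]) (Z2.[-1]) (Z3.[-1]) (N%:R : F) (n%:R : F) NE NF nF F1 F2 F3.
    move=> z1 z2 z3 M m ME M0 m0 F1 F2 F3.
    have G (x y : F) : 2%:R * x = - (2%:R * M * y) -> x = - (M * y).
      by move=> E; apply: (mulfI two_neq0); rewrite E; ring.
    move/G: F1 => F1; move/G: F2 => F2; move/G: F3 => F3.
    (* Eliminating z2 and z3 leaves 12 M^2 (M - 1) z1 = 0, where M is the order. *)
    have z2E : z2 = 12%:R * (M - 2%:R * kappa) * z1.
      transitivity (12%:R * kappa * z2); first by rewrite kappaE mul1r.
      transitivity (- (12%:R * (- (2%:R * kappa * z1) - kappa * z2)) - 24%:R * kappa * z1); first by ring.
      by rewrite F1; ring.
    have z3E : 6%:R * z3 = (M - 4%:R * kappa) * z2 + 4%:R * kappa * z1.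
      transitivity (4%:R * kappa * z1 - 4%:R * kappa * z2
        - (4%:R * kappa * z1 - 4%:R * kappa * z2 - 6%:R * z3)); first by ring.
      by rewrite F2; ring.
    have z10 : z1 = 0.
      have c0 : 12%:R * (M * M * m) != 0 by rewrite !mulf_neq0.
      apply: (mulfI c0); rewrite mulr0.
      transitivity ((M - 6%:R * kappa) * (6%:R * z3)
          - 6%:R * (48%:R * kappa ^+ 3 * z1 + 8%:R * kappa ^+ 2 * z2)
          - (12%:R * kappa - 1) * (- (12%:R * M ^+ 2) - 4%:R * kappa * M + 24%:R * kappa ^+ 2) * z1).
        by rewrite z3E z2E ME; ring.
      rewrite kappaE subrr !mul0r subr0.
      transitivity (6%:R * (M * z3 + (48%:R * kappa ^+ 3 * -1 * z1 - 6%:R * kappa * z3 - 8%:R * kappa ^+ 2 * z2))); first by ring.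
      by rewrite F3; ring.
    have z20 : z2 = 0 by rewrite z2E z10 mulr0.
    split=> //; have six_neq0 : 6%:R != 0 :> F by rewrite (natrM _ 2 3) mulf_neq0.
    by apply: (mulfI six_neq0); rewrite z3E z20 z10 !mulr0 addr0.
  have fact (Z : {poly F}) : Z.[-1] = 0 -> exists Z', Z = Z' * xi.
    by move=> /eqP/factor_theorem.
  have [Z1' Z1'E] := fact _ z1; have [Z2' Z2'E] := fact _ z2; have [Z3' Z3'E] := fact _ z3.
  exists Z1', Z2', Z3'; rewrite [xi ^+ N.+1]exprS !mulrA -Z1'E -Z2'E -Z3'E.
  by split.
have p_gt1 := prime_gt1 (pcharf_prime pF).
have [|Z1 [Z2 [Z3 [Z1E Z2E Z3E]]]] := divY p; first by rewrite p_gt1 leqnn.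
have zero Y Z : Y \in [:: Y1; Y2; Y3] -> Y = Z * xi ^+ p -> Y = 0.
  move=> /init[szY _] YE; apply/eqP; apply: contraLR szY => Y0; rewrite -ltnNge.
  have Z0 : Z != 0 by apply: contraNneq Y0 => Z0; rewrite YE Z0 mul0r.
  rewrite YE size_mul ?expf_neq0 // size_exp_XsubC addnS /= -[ltnLHS]add0n ltn_add2r.
  by rewrite size_poly_gt0.
by split; [apply: (zero _ Z1)|apply: (zero _ Z2)|apply: (zero _ Z3)];
  rewrite // !inE eqxx ?orbT.
Qed.
End Fuchs.

(** * The p-th power of the Ramanujan vector field *)

Section Slice.
Variable F : fieldType.
Local Notation S := {mpoly F[3]}.
Local Notation t1 := ('X_i0 : S).
Local Notation t2 := ('X_i1 : S).
Local Notation t3 := ('X_i2 : S).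
Local Notation v := (@ramanujan F).
Local Notation k := (inv12 F).
Hypothesis two_neq0 : 2%:R != 0 :> F.
Hypothesis three_neq0 : 3%:R != 0 :> F.
Local Notation kappa := (1 / 12%:R : F).
Local Notation K := (kappa%:P).
Local Notation at_cusp := (@at_cusp F).

Definition slice_scale (i : 'I_3) : F := [tuple - kappa; kappa; 8%:R * kappa ^+ 3]`_i.
Definition slice_point (i : 'I_3) : {poly F} :=
  (slice_scale i)%:P * 'X^(if i == i2 then 1%N else 0%N).

(** Restriction to the line t1 = -1/12, t2 = 1/12. The coordinate X is scaled so that
    the discriminant vanishes at X = 1 and X = -1, the point a being X = -1. *)
Definition slice : S -> {poly F} := mmap polyC slice_point.
HB.instance Definition _ := GRing.RMorphism.on slice.

Lemma sliceD g h : slice (g + h) = slice g + slice h. Proof. exact: rmorphD. Qed.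
Lemma sliceB g h : slice (g - h) = slice g - slice h. Proof. exact: rmorphB. Qed.
Lemma sliceM g h : slice (g * h) = slice g * slice h. Proof. exact: rmorphM. Qed.
Lemma sliceX g n : slice (g ^+ n) = slice g ^+ n. Proof. exact: rmorphXn. Qed.
Lemma slice_nat n : slice n%:R = n%:R. Proof. exact: rmorph_nat. Qed.
Lemma sliceC c : slice c%:MP = c%:P. Proof. exact: mmapC. Qed.
Lemma slice_inv12 : slice k = K. Proof. exact: sliceC. Qed.

Lemma slice_t1 : slice t1 = - K.
Proof. by rewrite /slice mmapX mmap1U /slice_point inord3_neq mulr1 /slice_scale inordK //= polyCN. Qed.
Lemma slice_t2 : slice t2 = K.
Proof. by rewrite /slice mmapX mmap1U /slice_point inord3_neq mulr1 /slice_scale inordK. Qed.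
Lemma slice_t3 : slice t3 = 8%:R * K ^+ 3 * 'X.
Proof.
rewrite /slice mmapX mmap1U /slice_point eqxx expr1 /slice_scale inordK //=.
by rewrite (rmorphM polyC) (rmorphXn polyC) /= polyC_natr.
Qed.

Lemma horner_slice g : (slice g).[-1] = at_cusp g.
Proof.
elim/mpoly_ring_ind: g => [c|i|g h IHg IHh|g h IHg IHh].
- by rewrite sliceC hornerC at_cuspC.
- move: i; apply: ord3_ind.
  + by rewrite slice_t1 -polyCN hornerC at_cusp_t1.
  + by rewrite slice_t2 hornerC at_cusp_t2.
  + rewrite slice_t3 at_cusp_t3 // -polyC_natr -rmorphXn.
    by rewrite !hornerM hornerX !hornerC; ring.
- by rewrite sliceD hornerD IHg IHh at_cuspD.
- by rewrite sliceM hornerM IHg IHh at_cuspM.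
Qed.

Lemma deriv_slice g : (slice g)^`() = 8%:R * K ^+ 3 * slice (mderiv i2 g).
Proof.
elim/mpoly_ring_ind: g => [c|i|g h IHg IHh|g h IHg IHh].
- by rewrite sliceC mderivC derivC rmorph0 mulr0.
- have dd := deriv_derivation F.
  have dC : (8%:R * K ^+ 3)^`() = 0 by rewrite -polyC_natr -rmorphXn -polyCM derivC.
  rewrite mderivXU; move: i; apply: ord3_ind; rewrite ?eqxx ?inord3_neq slice_nat mulr_natr /=.
  + by rewrite slice_t1 derivN derivC oppr0.
  + by rewrite slice_t2 derivC.
  + by rewrite slice_t3 derivM dC derivX mul0r add0r mulr1.
- by rewrite sliceD derivD IHg IHh mderivD sliceD mulrDr.
- by rewrite sliceM derivM IHg IHh mderivM sliceD !sliceM; ring.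
Qed.

(** Euler's relation eliminates the derivative in t2, which is transversal to the
    line. *)
Lemma slice_ramanujan g d : g \is d.-homog for wt -> mderiv i0 g = 0 ->
  2%:R * slice (v g) = ('X ^+ 2 - 1) * (slice g)^`() - (2 * d)%:R * K * (1 + 'X) * slice g.
Proof.
move=> hg dg; have := euler_homog hg; move/(congr1 slice).
rewrite /euler ramanujan_chain // dg !mulr0 !add0r ramanujan_t2 // ramanujan_t3 // deriv_slice.
rewrite !(slice_inv12, slice_t1, slice_t2, slice_t3, slice_nat, sliceX, sliceM, sliceB, sliceD).
have : 12%:R * K = 1 by rewrite -polyC_natr -polyCM kappaE.
move: K (slice g) (slice (mderiv i1 g)) (slice (mderiv i2 g)) => c G G1 G2 cE E.
rewrite natrM; move: (d%:R : {poly F}) E => D E.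

have -> : 2%:R * D * c * (1 + 'X) * G = 2%:R * c * (1 + 'X) * (D * G) by ring.
rewrite -E; apply/eqP; rewrite -subr_eq0; apply/eqP.
transitivity ((12%:R * c - 1) * (8%:R * c ^+ 3 * 'X ^+ 2 * G2 - 8%:R * c ^+ 2 * 'X * G1)).
  by ring.
by rewrite cE subrr mul0r.
Qed.

Lemma coef_slice g j : (slice g)`_j =
  \sum_(m <- msupp g) g@_m * (\prod_i slice_scale i ^+ m i) * (m i2 == j)%:R.
Proof.
rewrite /slice /mmap coef_sum; apply: eq_bigr => m _.
rewrite /mmap1.
under [X in _ * X]eq_bigr => i _ do rewrite /slice_point exprMn -rmorphXn -exprM.
rewrite big_split /= -rmorph_prod mulrA -rmorphM coefCM; congr (_ * _).
by rewrite big_ord3 /= eqxx !inord3_neq !mul0n mul1n !expr0 !mul1r coefXn eq_sym.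
Qed.

(** A power of t3 in a polynomial of weight d has exponent at most d / 6. *)
Lemma size_slice g d : g \is d.-homog for wt -> (6 * (size (slice g)).-1 <= d)%N.
Proof.
move=> /dhomogP hg; have [->|s0] := eqVneq (slice g) 0; first by rewrite size_poly0.
have : (slice g)`_(size (slice g)).-1 != 0 by rewrite -lead_coefE lead_coef_eq0.
rewrite coef_slice; set j := _.-1 => /eqP nz.
have [/hasP[m gm /eqP mj]|/hasPn nm] := boolP (has (fun m : 'X_{1..3} => m i2 == j) (msupp g)).
  by have /= <- := hg m gm; rewrite wtE mj; lia.
case: nz; rewrite big_seq big1 // => m /nm /negPf ->; exact: mulr0.
Qed.

(** In a given weight, the exponent of t3 determines that of t2. *)
Lemma slice_eq0 g d : g \is d.-homog for wt -> t1_free g -> slice g = 0 -> g = 0.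
Proof.
move=> /dhomogP hg fg s0; apply/eqP; rewrite -msupp_eq0; case E : (msupp g) => [//|m r].
have gm : m \in msupp g by rewrite E mem_head.
have others : \sum_(m' <- msupp g | m' != m)
    g@_m' * (\prod_i slice_scale i ^+ m' i) * (m' i2 == m i2)%:R = 0.
  rewrite big_seq_cond; apply: big1 => m' /andP[gm' m'm].
  case: eqP => [m2|_]; last exact: mulr0.
  have := hg m gm; have := hg m' gm'; rewrite /= !wtE (fg m gm) (fg m' gm') m2 => w1 w2.
  suff mm : m' = m by rewrite mm eqxx in m'm.
  by apply/mnmP; apply: ord3_ind; rewrite ?(fg m gm) ?(fg m' gm') //; lia.
have := coef_slice g (m i2); rewrite s0 coef0 (bigD1_seq m) //= others addr0 eqxx mulr1.
move=> /esym/eqP; rewrite mulf_eq0 mcoeff_eq0 gm /= => /prodf_eq0[i _].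
have c0 : kappa != 0 by rewrite mul1r invr_neq0 // twelve_neq0.
have e0 : 8%:R != 0 :> F by rewrite (natrM _ 2 4) (natrM _ 2 2) !mulf_neq0.
suff : slice_scale i != 0 by move=> /(expf_neq0 (m i)) /negPf ->.
move: i; apply: ord3_ind; rewrite /slice_scale inordK //= ?oppr_eq0 //.
by rewrite mulf_neq0 ?expf_neq0.
Qed.

Variable s : nat.
Hypothesis s_gt1 : (1 < s)%N.
Hypothesis pF : s.*2.+1 \in [pchar F].
Local Notation p := s.*2.+1.
Local Notation hasse := (hasse F s).
Local Notation first_integral := (first_integral F s).

(** The value of v^p predicted by the p-curvature of the Gauss-Manin connection: an
    element of sl2 over S that is nilpotent and killed by the horizontal functional with
    values (A, f). *)
Definition sl2_field (g : S) : S :=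
  hasse ^+ 2 * v g - hasse * first_integral * euler g + first_integral ^+ 2 * mderiv i0 g.
Definition defect (g : S) : S := iter p v g - sl2_field g.

Let vD := ramanujan_derivation two_neq0 three_neq0.

Lemma mderiv1_euler (g : S) : mderiv i0 (euler g) = euler (mderiv i0 g) + 2%:R * mderiv i0 g.
Proof.
have dM := mderiv_derivation F.
rewrite /euler !(mderivXU, derivation_nat (dM _), derivation_natM (dM _),
  derivationB (dM _), mderivM, mderivD) !eqxx !inord3_neq /=.
rewrite (mderiv_comm i1 i0) (mderiv_comm i2 i0); ring.
Qed.

Lemma defectD g h : defect (g + h) = defect g + defect h.
Proof.
rewrite /defect (derivation_iterD vD) /sl2_field.
rewrite (derivationD vD) (derivationD (euler_derivation F)) mderivD.
by move: (iter p v g) (iter p v h) => x y; ring.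
Qed.

Lemma defectM g h : defect (g * h) = defect g * h + g * defect h.
Proof.
rewrite /defect (derivationM (derivation_iter_pchar vD (pchar_mpoly pF))) /sl2_field.
rewrite (derivationM vD) (derivationM (euler_derivation F)) mderivM.
by move: (iter p v g) (iter p v h) => x y; ring.
Qed.

Lemma defect_derivation : derivation defect.
Proof. by split=> [g h|g h]; [exact: defectD|exact: defectM]. Qed.

Lemma defectC c : defect c%:MP = 0.
Proof.
rewrite /defect /sl2_field ramanujanC // eulerC mderivC !mulr0 subrr addr0 subr0.
elim: (s.*2) => [|n IHn]; first by rewrite /= ramanujanC.
by rewrite iterS IHn (derivation0 vD).
Qed.

(** The coefficients of [sl2_field] satisfy v A = - f and v f = 0, which is what makes
    it commute with v. *)
Lemma ramanujan_defect g : v (defect g) = defect (v g).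
Proof.
rewrite /defect (derivationB vD) -iterS iterSr; congr (_ - _).
have vA := ramanujan_hasse two_neq0 three_neq0 s_gt1 pF.
have vf := ramanujan_first_integral two_neq0 three_neq0 s_gt1 pF.
rewrite /sl2_field !expr2 (derivationD vD) (derivationB vD) !(derivationM vD) vA vf.
rewrite euler_ramanujan // mderiv1_ramanujan //.
by move: (v (v g)) (v (euler g)) (v (mderiv i0 g)) => x y z; ring.
Qed.

Lemma mderiv1_defect g : mderiv i0 (defect g) = defect (mderiv i0 g).
Proof.
have dA := mderiv1_hasse pF.
have df := mderiv1_first_integral s_gt1 pF.
rewrite /defect mderivB mderiv1_iter_ramanujan // (pcharf0 (pchar_mpoly pF)) mul0r addr0.
congr (_ - _); rewrite /sl2_field mderivD mderivB !expr2 !mderivM dA df.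
rewrite mderiv1_euler mderiv1_ramanujan //.
by move: (v (mderiv i0 g)) (euler (mderiv i0 g)) => x y; ring.
Qed.

(** Apply the derivation [defect], which commutes with v, to the formulas for the
    values of v at the coordinates. *)
Lemma ramanujan_defectXU : [/\
  v (defect t1) = 2%:R * t1 * defect t1 - k * defect t2,
  v (defect t2) = 4%:R * defect t1 * t2 + 4%:R * t1 * defect t2 - 6%:R * defect t3
  & v (defect t3) = 6%:R * defect t1 * t3 + 6%:R * t1 * defect t3 - 8%:R * k * t2 * defect t2].
Proof.
have dD := defect_derivation; have dk : defect k = 0 by apply: defectC.
rewrite !ramanujan_defect ramanujan_t1 // ramanujan_t2 // ramanujan_t3 //.
rewrite !expr2 !(derivationB dD) -!mulrA !(derivation_natM dD) !(derivationM dD) dk.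
by move: (defect t1) (defect t2) (defect t3) => x y w; split; ring.
Qed.

Lemma mderiv1_defectXU i : mderiv i0 (defect 'X_i) = 0.
Proof.
rewrite mderiv1_defect mderivXU -mpolyC_nat; exact: defectC.
Qed.

Lemma homog_defect (i : 'I_3) : defect 'X_i \is (2 * p + 2 * i.+1).-homog for wt.
Proof.
have hX := homogXU F i.
have hA : hasse \is (s.*2).-homog for wt by apply: homog_coef_weierstrass; lia.
have hf : first_integral \is (s.*2.+2).-homog for wt by apply: homog_coef_weierstrass; lia.
have hM n c u w e : (n = c + e)%N -> u \is c.-homog for wt -> w \is e.-homog for wt ->
  (u * w : S) \is n.-homog for wt.
  by move=> ->; apply: dhomogM.
apply: rpredB.
  have := homog_iter_ramanujan p hX; rewrite (_ : (_ + _ = 2 * p + 2 * i.+1)%N) //; lia.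
apply: rpredD; first apply: rpredB.
- apply: (hM _ (s.*2 * 2)%N _ _ (2 * i.+1).+2); [lia|exact: dhomogMn|exact: homog_ramanujan].
- apply: (hM _ (s.*2 + s.*2.+2)%N _ _ (2 * i.+1)); [lia|exact: dhomogM|].
  by rewrite (euler_homog hX) mulr_natl rpredMn.
- apply: (homog_mderiv (n := (s.*2.+2 * 2)%N) (m := (2 * i.+1)%N)) => //; last exact: dhomogMn.
  by rewrite inordK //; lia.
Qed.

Lemma at_cusp_defect g : at_cusp (defect g) = 0.
Proof.
rewrite /defect iterS /sl2_field; have f0 := at_cusp_first_integral two_neq0 three_neq0 s_gt1.
have := ramanujan_cusp two_neq0 three_neq0 (iter s.*2 v g).
have := ramanujan_cusp two_neq0 three_neq0 g.
move: (v (iter s.*2 v g)) (v g) (euler g) (mderiv i0 g) => x y w u y0 x0.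
by rewrite !(at_cuspN, at_cuspD, at_cuspM, at_cuspX) x0 y0 f0; ring.
Qed.

(** Both v^p and v have eigenvalue -1 along b, as p is odd, and [sl2_field] agrees with v to
    first order at a since A = 1 and f = 0 to first order in the direction b. *)
Lemma along_tangent_defect g : along_tangent (defect g) = 0.
Proof.
rewrite /defect along_tangentB along_tangent_iter // /sl2_field.
have f0 := at_cusp_first_integral two_neq0 three_neq0 s_gt1; have A1 := at_cusp_hasse two_neq0 three_neq0 s.
have df := along_tangent_first_integral two_neq0 three_neq0 s_gt1 pF.
have dA := along_tangent_hasse two_neq0 three_neq0 s_gt1 pF.
have := ramanujan_cusp two_neq0 three_neq0 g.
have := along_tangent_ramanujan two_neq0 three_neq0 g.
move: (v g) (euler g) (mderiv i0 g) => y w u dy y0.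
rewrite !(along_tangentD, along_tangentN, along_tangentM, expr2) dy y0 dA df.
rewrite !at_cuspM A1 f0 -signr_odd /= odd_double /=; ring.
Qed.

(** At a, the derivative in t1 vanishes, and so do the derivatives along b and along
    the Euler field. Modulo d/dt1, these two directions are independent. *)
Lemma at_cusp_mderiv2_defect i : at_cusp (mderiv i2 (defect 'X_i)) = 0.
Proof.
have := euler_homog (homog_defect i); have := along_tangent_defect 'X_i.
have := mderiv1_defectXU i; have := at_cusp_defect 'X_i.
rewrite /euler along_tangentE; move: (defect 'X_i) => y y0 dy.
rewrite dy mulr0 add0r -mpolyC0 at_cuspC mul0r add0r.
move: (mderiv i1 y) (mderiv i2 y) => y1 y2 T /(congr1 at_cusp).
rewrite at_cuspD !at_cuspM !at_cusp_nat y0 mulr0 at_cusp_t2 at_cusp_t3 // => E.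
move: (at_cusp y1) (at_cusp y2) T E => x w T E.
have xE : x = kappa * w.
  have := kappaE two_neq0 three_neq0; move: (kappa) E => c E cE.
  have c0 : 4%:R * c != 0.
    rewrite mulf_neq0 //; first by rewrite (natrM _ 2 2) mulf_neq0.
    by apply/eqP => c0; move/eqP: cE; rewrite c0 mulr0 eq_sym oner_eq0.
  apply: (mulfI c0).
  transitivity (4%:R * c * x + 6%:R * - (8%:R * c ^+ 3) * w + 48%:R * c ^+ 3 * w); first by ring.
  rewrite E.
  transitivity (12%:R * c * (4%:R * c ^+ 2 * w)); first by ring.
  by rewrite cE; ring.
have four_neq0 : 4%:R != 0 :> F by rewrite (natrM _ 2 2) mulf_neq0.
apply: (mulfI four_neq0); rewrite mulr0 -T xE.
by have n12 := twelve_neq0 two_neq0 three_neq0; field; rewrite n12 three_neq0.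
Qed.

(** Restricted to the line, the values of [defect] at the coordinates solve the Fuchsian
    system, vanish to order 2 at a and have degree less than p, so they are zero. This
    gives back [defect 'X_i0] = 0, because it does not involve t1, and the differential
    system then yields the other two coordinates. *)
Lemma defect_eq0 g : defect g = 0.
Proof.
pose Y i := slice (defect 'X_i).
have init i : (size (Y i) <= p)%N /\ ((Y i).[-1] = 0 /\ (Y i)^`().[-1] = 0).
  split; last split.
  - have := size_slice (homog_defect i); rewrite -/(Y i); have := ltn_ord i; lia.
  - by rewrite horner_slice at_cusp_defect.
  - by rewrite deriv_slice hornerM horner_slice at_cusp_mderiv2_defect mulr0.
have [E1 E2 E3] := ramanujan_defectXU.
have ode (i : 'I_3) := slice_ramanujan (homog_defect i) (mderiv1_defectXU i).
(* In F the weights 2 p + 2, 2 p + 4 and 2 p + 6 are 2, 4 and 6. *)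
have wtK (i : 'I_3) : (2 * (2 * p + 2 * i.+1))%:R = (4 * i.+1)%:R :> {poly F}.
  have -> : (2 * (2 * p + 2 * i.+1) = 4 * p + 4 * i.+1)%N by lia.
  by rewrite natrD natrM (pcharf0 (rmorph_pchar (@polyC F) pF)) mulr0 add0r.
have Y0 : [/\ Y i0 = 0, Y i1 = 0 & Y i2 = 0].
  apply: (fuchs_polynomial_zero two_neq0 three_neq0 (kappaE two_neq0 three_neq0) pF).
  - have := ode i0; rewrite wtK inordK // E1 => <-.
    by rewrite sliceB !sliceM slice_nat slice_inv12 slice_t1; rewrite /Y; ring.
  - have := ode i1; rewrite wtK inordK // E2 => <-.
    by rewrite sliceB sliceD !sliceM !slice_nat slice_t1 slice_t2; rewrite /Y; ring.
  - have := ode i2; rewrite wtK inordK // E3 => <-.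
    rewrite sliceB sliceD !sliceM !slice_nat slice_inv12 slice_t1 slice_t2 slice_t3.
    by rewrite /Y; ring.
  - by move=> y; rewrite !inE => /or3P[] /eqP ->; apply: init.
have d1 : defect t1 = 0.
  have hd := homog_defect i0; rewrite inordK // in hd.
  apply: (slice_eq0 hd); last by case: Y0.
  by apply: (t1_free_of_mderiv pF _ _ hd); [lia|lia|exact: mderiv1_defectXU].
have d2 : defect t2 = 0.
  move: E1; rewrite d1 (derivation0 vD) mulr0 sub0r => /esym/eqP.
  rewrite oppr_eq0 => /eqP E; rewrite -[LHS]mul1r -(inv12E two_neq0 three_neq0) -mulrA E.
  exact: mulr0.
have d3 : defect t3 = 0.
  move: E2; rewrite d1 d2 (derivation0 vD) !mulr0 mul0r !add0r => /esym/eqP.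
  rewrite oppr_eq0 => /eqP E; rewrite -[LHS]mul1r -(inv12E two_neq0 three_neq0).
  by rewrite (_ : 12%:R * k * defect t3 = 2%:R * k * (6%:R * defect t3)); [rewrite E mulr0|ring].
elim/mpoly_ring_ind: g => [c|i|g h IHg IHh|g h IHg IHh].
- exact: defectC.
- by move: i; apply: ord3_ind.
- by rewrite defectD IHg IHh addr0.
- by rewrite defectM IHg IHh mul0r mulr0 addr0.
Qed.

(** Modulo A - 1 and f the right-hand side is v. *)
Theorem ramanujan_iter_p g : iter p v g =
  hasse ^+ 2 * v g - hasse * first_integral * euler g + first_integral ^+ 2 * mderiv i0 g.
Proof. by apply/eqP; rewrite -subr_eq0; apply/eqP; exact: defect_eq0. Qed.

End Slice.

(** * The theorem *)

Theorem theorem4p4 (p : nat) (p_prime : prime p) (p_neq2 : p <> 2%N)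
    (p_neq3 : p <> 3%N) :
  let v := @ramanujan 'F_p in
  let a : 'cV['F_p]_3 := vec3 (- (1 / 12%:R)) (1 / 12%:R) (- (1 / 216%:R)) in
  let b : 'cV['F_p]_3 := vec3 2%:R 20%:R (7%:R / 3%:R) in
  exists f : {mpoly 'F_p[3]},
    [/\ f != 0, v f = 0, f \is p.+1.-homog for wt &
     exists A : {mpoly 'F_p[3]},
       let I := ideal_gen [tuple A - 1; f] in
       (forall c : 'F_p, ~ ideal_gen [tuple f] (A - c%:MP)) /\
       ideal_gen [tuple f] (v A) /\
       is_curve I /\
       passes_through I a /\
       smooth_curve_at [tuple A - 1; f] a /\
       tangent_to_vector I a b /\
       (forall g, I g -> I (v g)) /\
       (forall g, I (iter p v g - v g))].
Proof.
pose F : fieldType := 'F_p.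
have pF : p \in [pchar F] by apply: pchar_Fp.
have small_neq0 n : (0 < n < p)%N -> n%:R != 0 :> F.
  by case/andP=> n0 np; rewrite -(dvdn_pcharf pF) gtnNdvd.
have p_gt3 : (3 < p)%N by have := prime_gt1 p_prime; lia.
have two_neq0 : 2%:R != 0 :> F by apply: small_neq0; lia.
have three_neq0 : 3%:R != 0 :> F by apply: small_neq0; lia.
pose s := p./2.
have pE : s.*2.+1 = p.
  have [//|p_odd] := even_prime p_prime.
  by rewrite -[RHS]odd_double_half p_odd.
have s_gt1 : (1 < s)%N by lia.
rewrite -pE in pF; move=> v a b.
pose A := hasse F s; pose f := first_integral F s.
have vA : v A = - f by apply: ramanujan_hasse.
have vf : v f = 0 by apply: ramanujan_first_integral.
have Aa : at_cusp A = 1 by apply: at_cusp_hasse.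
have fa : at_cusp f = 0 by apply: at_cusp_first_integral.
have dA : mderiv i0 A = 0 by apply: mderiv1_hasse pF.
have df : mderiv i0 f = A by apply: mderiv1_first_integral pF.
have hA : A \is (s.*2).-homog for wt by apply: homog_coef_weierstrass; lia.
have hf : f \is (s.*2.+2).-homog for wt by apply: homog_coef_weierstrass; lia.
(* A and f vanish at the origin, and A = 1, f = 0 at a: so A is not constant modulo f. *)
have A00 : A@_0%MM = 0 by apply: (dhomog_nemf_coeff hA); rewrite /= wt0; lia.
have f00 : f@_0%MM = 0 by apply: (dhomog_nemf_coeff hf); rewrite /= wt0.
have A_neq0 : A != 0 by apply/eqP => A0; move/eqP: Aa; rewrite A0 rmorph0 eq_sym oner_eq0.
exists f; split=> //.
- by apply: contraNneq A_neq0 => f0; rewrite -df f0 mderiv0.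
- by have := hf; rewrite (congr1 succn pE).
exists A => I.
have IP g : I g <-> exists x y, g = x * (A - 1) + y * f by apply: ideal_gen2P.
have a_on_I g : I g -> at_cusp g = 0.
  case/IP=> x [y ->]; rewrite -mpolyC1 at_cuspD !at_cuspM at_cuspB at_cuspC Aa fa; ring.
split; [|split; [|split; [|split; [|split; [|split; [|split]]]]]].
- move=> c /ideal_gen1P[x E].
  have c0 : c = 0.
    have := congr1 (mcoeff 0%MM) E; rewrite rmorphM /= f00 mulr0 mcoeffB A00 mcoeffC eqxx mulr1.
    by move=> /eqP; rewrite sub0r oppr_eq0 => /eqP.
  have := congr1 (@at_cusp F) E.
  rewrite at_cuspM at_cuspB at_cuspC Aa fa mulr0 c0 subr0 => /eqP.
  by rewrite oner_eq0.
- by apply/ideal_gen1P; exists (-1); rewrite vA mulN1r.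
- pose B := f - 'X_i0 * A.
  have fE : f = 'X_i0 * A + B by rewrite /B addrC subrK.
  rewrite /I [in X in is_curve X]fE; apply: is_curve_graph.
  + by apply: (t1_free_of_mderiv pF _ _ hA dA); lia.
  + apply: (t1_free_of_mderiv (d := s.*2.+2) pF); [lia|lia| |].
      by apply: rpredB => //; apply: (dhomogM (homog_t1 F) hA).
    by rewrite mderivB mderivM mderivXU eqxx mulr1n dA df; ring.
  + by apply/eqP => A1; move/eqP: A00; rewrite A1 mcoeff1 eqxx oner_eq0.
  + by rewrite -fE => /a_on_I/eqP; rewrite -mpolyC1 at_cuspC oner_eq0.
- exact: a_on_I.
- exact: smooth_cusp.
- move=> g /IP[x [y ->]]; change (along_tangent (x * (A - 1) + y * f) = 0).
  rewrite along_tangentD !along_tangentM along_tangentB.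
  rewrite along_tangent_hasse // along_tangent_first_integral // -mpolyC1 along_tangentC.
  by rewrite at_cuspB at_cuspC Aa fa; ring.
- have tangent (D : {mpoly F[3]} -> {mpoly F[3]}) x y :
      derivation D -> D A = - f -> D f = 0 ->
      D (x * (A - 1) + y * f) = D x * (A - 1) + (D y - x) * f.
    move=> dD DA Df; rewrite (derivationD dD) !(derivationM dD) (derivationB dD) (derivation1 dD).
    by rewrite DA Df; ring.
  move=> g /IP[x [y ->]]; apply/IP; exists (v x), (v y - x).
  by apply: tangent => //; apply: ramanujan_derivation.
- move=> g; apply/IP; rewrite -(congr1 (fun n => iter n v g) pE) ramanujan_iter_p //.
  (* A^2 - 1 and f lie in I. *)
  by exists ((A + 1) * v g), (f * mderiv i0 g - A * euler g); rewrite -/A -/f -/v; ring.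
Qed.
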